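(* Up to isomorphism, the elements of $\mathcal{Q}_{-5}$ are the graphs $G$ with vertex set $\mathbb{N}_n$, where $n\geq 12$, such that, with $X=\mathbb{N}_{n-5}$: $G[X]=Q_{n-5}$; for each $Y\in q_X^-$ (resp. $Y\in q_X^+$), $G[Y]$ is empty (resp. complete); and the graph $G_X$ is isomorphic to the bipartite graph $P_5$, with bipartition $\{X^-(n-5),Z\}$ where $Z\in\{X^-,X^+,X^-(1),X^+(1)\}$ (that is, $G_X\simeq P_5$ and its two colour classes are $X^-(n-5)$ and $Z$). In other words, a graph is isomorphic to an element of $\mathcal{Q}_{-5}$ if and only if it is isomorphic to a graph of this form.
   Context: Graphs are finite, simple and undirected; $G[X]$ is the subgraph induced by $X$ and $G-X=G[V(G)\setminus X]$. A graph is empty if it has no edges, complete if all pairs of distinct vertices are edges. A subset $I\subseteq V(G)$ is an interval of $G$ if every vertex outside $I$ is adjacent to all or to none of the vertices of $I$. The sets $\emptyset$, $V(G)$ and $\{x\}$ ($x\in V(G)$) are the trivial intervals. $G$ is indecomposable if all its intervals are trivial. For an indecomposable graph $G=(V,E)$, the indecomposability graph $\mathbb{I}(G)$ has vertex set $V$, and its edges are the pairs $\{x,y\}$ of distinct vertices such that $G-\{x,y\}$ is indecomposable. A graph $H$ is $X$-covered, for $X\subseteq V(H)$, if every edge of $H$ meets $X$. Let $\mathbb{N}_n=\{1,\dots,n\}$. $P_n$ is the graph on $\mathbb{N}_n$ in which $i\ne j$ are adjacent iff $|i-j|=1$. For $n\geq 4$, $Q_n$ is the graph on $\mathbb{N}_n$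 with edge set $E(P_{n-2})\cup\{\{n-1,i\}: i\in\mathbb{N}_n\setminus\{n-1,n-2\}\}$ (it is indecomposable). $\mathcal{Q}_{-5}$ is the set of indecomposable graphs $G$ with vertex set $\mathbb{N}_n$ for some $n\geq 12$ such that $\mathbb{I}(G)$ is $\{1,n-5\}$-covered and $G-\{n,n-1,n-2,n-3,n-4\}=Q_{n-5}$. For $G=(V,E)$ and $X\subseteq V$ with $|X|\geq 4$ and $G[X]$ indecomposable: $X^-$ (resp. $X^+$) is the set of $v\in V\setminus X$ adjacent to no vertex (resp. to every vertex) of $X$; for $u\in X$, $X(u)$ is the set of $v\in V\setminus X$ such that $\{u,v\}$ is an interval of $G[X\cup\{v\}]$, and $X^-(u)$ (resp. $X^+(u)$) is the set of $v\in X(u)$ not adjacent (resp. adjacent) to $u$. Put $q_X^-=\{X^-\}\cup\{X^-(u):u\in X\}$ and $q_X^+=\{X^+\}\cup\{X^+(u):u\in X\}$. If $|V\setminus X|\ge2$, $G_X$ is the graph with vertex set $V\setminus X$ in which $x\neq y$ are adjacent iff $G[X\cup\{x,y\}]$ is indecomposable. *)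

(* Defs.v *)
From mathcomp Require Import all_boot.

Set Implicit Arguments.
Unset Strict Implicit.
Unset Printing Implicit Defensive.

Record sgraph (V : finType) := SGraph {
  adj :> rel V;
  adj_sym : symmetric adj;
  adj_irrefl : irreflexive adj
}.

Definition graph_iso (V W : finType) (G : sgraph V) (H : sgraph W) : Prop :=
  exists2 f : V -> W, bijective f & forall x y, H (f x) (f y) = G x y.

Section Graphs.
Variables (V : finType) (G : sgraph V).
Implicit Types (X Y I A B : {set V}) (u v x y : V).

Definition induced_adj X : rel {x : V | x \in X} :=
  fun a b => G (val a) (val b).

Lemma induced_adj_sym X : symmetric (@induced_adj X).
Proof. by move=> x y; apply: adj_sym. Qed.

Lemma induced_adj_irrefl X : irreflexive (@induced_adj X).
Proof. by move=> x; apply: adj_irrefl. Qed.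

(* G[X], and G - X below *)
Definition induced X := SGraph (@induced_adj_sym X) (@induced_adj_irrefl X).

Definition delete X := induced (~: X).

Definition empty_graph : Prop := forall x y, ~~ G x y.

Definition complete_graph : Prop := forall x y, x != y -> G x y.

Definition interval I : bool :=
  [forall v in ~: I, [forall x in I, G v x] || [forall x in I, ~~ G v x]].

Definition trivial_interval I : bool :=
  [|| I == set0, I == setT | [exists x, I == [set x]]].

Definition indecomposable : bool :=
  [forall I : {set V}, interval I ==> trivial_interval I].

Definition covered X : Prop := forall x y, G x y -> (x \in X) || (y \in X).

(* {A, B} is a bipartition of G into two colour classes. *)
Definition bipartition A B : Prop :=
  [/\ A :&: B = set0, A :|: B = setT,
      {in A &, forall x y, ~~ G x y} & {in B &, forall x y, ~~ G x y}].

End Graphs.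

(* [val @^-1: A] is the part of A that lies in the vertex set of an induced
   subgraph. *)
Section Outside.
Variables (V : finType) (G : sgraph V).
Implicit Types (X : {set V}) (u v x y : V).

Definition indec_graph_adj : rel V :=
  fun x y => (x != y) && indecomposable (delete G [set x; y]).

Lemma indec_graph_adj_sym : symmetric indec_graph_adj.
Proof. by move=> x y; rewrite /indec_graph_adj eq_sym setUC. Qed.

Lemma indec_graph_adj_irrefl : irreflexive indec_graph_adj.
Proof. by move=> x; rewrite /indec_graph_adj eqxx. Qed.

(* The indecomposability graph I(G). *)
Definition indec_graph := SGraph indec_graph_adj_sym indec_graph_adj_irrefl.

(* X^-, X^+, X(u), X^-(u) and X^+(u); the last three are used for u in X. *)
Definition Xm X : {set V} := [set v in ~: X | [forall x in X, ~~ G v x]].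

Definition Xp X : {set V} := [set v in ~: X | [forall x in X, G v x]].

Definition Xat X u : {set V} :=
  [set v in ~: X | interval (induced G (v |: X)) (val @^-1: [set u; v])].

Definition Xatm X u : {set V} := [set v in Xat X u | ~~ G v u].

Definition Xatp X u : {set V} := [set v in Xat X u | G v u].

Definition qm X : {set {set V}} := Xm X |: [set Xatm X u | u in X].

Definition qp X : {set {set V}} := Xp X |: [set Xatp X u | u in X].

Definition outer_adj X : rel {x : V | x \in ~: X} :=
  fun a b => (a != b) && indecomposable (induced G (X :|: [set val a; val b])).

Lemma outer_adj_sym X : symmetric (@outer_adj X).
Proof.
by move=> a b; rewrite /outer_adj eq_sym [[set val a; val b]]setUC.
Qed.

Lemma outer_adj_irrefl X : irreflexive (@outer_adj X).
Proof. by move=> x; rewrite /outer_adj eqxx. Qed.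

(* The graph G_X on V \ X. *)
Definition outer_graph X := SGraph (@outer_adj_sym X) (@outer_adj_irrefl X).

End Outside.

(* The vertex set {1, ..., n} is represented by 'I_n, where i : 'I_n stands for
   the vertex i.+1. Formulas about vertices are written with these labels, as
   natural numbers from 1 to n. *)

Definition path_rel : rel nat := fun a b => (a.+1 == b) || (b.+1 == a).

Lemma path_rel_sym : symmetric path_rel.
Proof. by move=> a b; rewrite /path_rel orbC. Qed.

Lemma path_rel_irrefl : irreflexive path_rel.
Proof. by move=> a; rewrite /path_rel orbb; elim: a. Qed.

Definition path_adj n : rel 'I_n := fun i j => path_rel i.+1 j.+1.

Lemma path_adj_sym n : symmetric (@path_adj n).
Proof. by move=> i j; apply: path_rel_sym. Qed.

Lemma path_adj_irrefl n : irreflexive (@path_adj n).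
Proof. by move=> i; apply: path_rel_irrefl. Qed.

Definition P_graph n := SGraph (@path_adj_sym n) (@path_adj_irrefl n).

(* The edge {n-1, b} of Q_n, oriented: a = n-1 and b is neither n-1 nor n-2. *)
Definition Q_star n a b : bool :=
  [&& a == n - 1, b != n - 1 & b != n - 2].

Definition Q_adj n : rel 'I_n := fun i j =>
  let a := i.+1 in let b := j.+1 in
  [|| [&& a <= n - 2, b <= n - 2 & path_rel a b], Q_star n a b | Q_star n b a].

Lemma Q_adj_sym n : symmetric (@Q_adj n).
Proof.
move=> i j; rewrite /Q_adj /= path_rel_sym andbCA.
by rewrite [Q_star _ _ _ || _]orbC.
Qed.

Lemma Q_adj_irrefl n : irreflexive (@Q_adj n).
Proof.
by move=> i; rewrite /Q_adj /Q_star /= path_rel_irrefl !andbF orbb /= andbA andbN.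
Qed.

(* Used only for n >= 4. *)
Definition Q_graph n := SGraph (@Q_adj_sym n) (@Q_adj_irrefl n).

(* G[X] = H as graphs whose vertex sets are sets of labels, where H has vertex
   set {1, ..., m}: an equality, not an isomorphism. *)
Definition induced_eq n (G : sgraph 'I_n) (X : {set 'I_n}) m (H : sgraph 'I_m) :
    Prop :=
  (forall a, a < m <-> exists2 x : 'I_n, x \in X & nat_of_ord x = a) /\
  (forall (x y : 'I_n) (i j : 'I_m), x \in X -> y \in X ->
     nat_of_ord x = i -> nat_of_ord y = j -> G x y = H i j).

Definition label_set n (s : seq nat) : {set 'I_n} := [set i : 'I_n | i.+1 \in s].

(* The class Q_{-5}, for a graph with vertex set {1, ..., n}. *)
Definition in_Qm5 n (G : sgraph 'I_n) : Prop :=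
  [/\ 12 <= n,
      indecomposable G,
      covered (indec_graph G) (label_set n [:: 1; n - 5]) &
      induced_eq G (~: label_set n [:: n; n - 1; n - 2; n - 3; n - 4])
        (Q_graph (n - 5))].

Definition Qm5_form n (G : sgraph 'I_n) : Prop :=
  12 <= n /\
  let X : {set 'I_n} := [set i : 'I_n | i.+1 <= n - 5] in
  [/\ induced_eq G X (Q_graph (n - 5)),
      {in qm G X, forall Y, empty_graph (induced G Y)},
      {in qp G X, forall Y, complete_graph (induced G Y)},
      graph_iso (outer_graph G X) (P_graph 5) &
      exists (v1 vm : 'I_n) (Z : {set 'I_n}),
        [/\ v1.+1 = 1, vm.+1 = n - 5,
            Z \in [:: Xm G X; Xp G X; Xatm G X v1; Xatp G X v1] &
            bipartition (outer_graph G X)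
              (val @^-1: Xatm G X vm) (val @^-1: Z)]].

(* Main.v *)
(* Call a vertex outside X attached to X when it looks to X like a vertex u of X
   (up to its adjacency with u) or like a constant. Since X and G are
   indecomposable, 5 vertices are left, and no two of them can be removed,
   parity and the Ehrenfeucht-Rozenberg theorem imply that X plus one or three
   outer vertices is never indecomposable. Hence every outer vertex is attached
   to X, adjacency to the ends of an edge of G_X is almost prescribed by the
   attachment, and a check of all graphs on 5 vertices leaves only G_X = P_5,
   with one attachment on each colour class. Exchanging a vertex u of X with an
   outer twin of it shows that u is 1 or n-5. The remaining wrong pairs of
   attachments are excluded by an indecomposable graph on at most 9 vertices,
   of the parity of n, made of an edge of G_X and of labels including 1 and n-5:
   by parity it extends to an indecomposable G-{x,y} that avoids {1,n-5}.
   Conversely, an explicit nontrivial interval of G-{x,y} is given for all x, y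
   outside {1,n-5}. *)

Require Import Defs.
From mathcomp Require Import all_boot zify.

Set Implicit Arguments.
Unset Strict Implicit.
Unset Printing Implicit Defensive.

(** * Intervals as subsets of the vertex set *)

Section Intervals.
Variables (V : finType) (G : sgraph V).
Implicit Types (X Y S I : {set V}) (B : option V) (t : option V * bool) (x y u v : V).

(** Both directions meet in [path_extension]: together with G[X], the two attachments and the order
    of the five outer vertices determine all adjacencies. The conditions on q_X^- and q_X^+ are
    contained in it, because between two vertices with the same attachment the prescribed adjacency
    is the sign of that attachment.

    The parity step works since X plus one or three outer vertices misses four or two vertices, an
    even number: adding pairs to such an indecomposable set ends at an indecomposable G - {x, y}
    with x and y outside X.

    The exchange step works since, for u other than 1 and n - 5, the exchanged set still contains
    both of these labels. The hypotheses then hold for it too, and so its outer vertices again show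
    only two attachments.

    In the certificates, n >= 12 appears as m = n - 5 >= 7. They use only labels close to the two
    ends, which makes one certificate valid for all larger m of the same parity. *)

Definition interval_of X I : Prop :=
  I \subset X /\ forall v x y, v \in X -> v \notin I -> x \in I -> y \in I ->
    G v x = G v y.

Lemma intervalP I : reflect (interval_of setT I) (interval G I).
Proof.
apply: (iffP forall_inP) => [h | [_ h] v].
  split=> [|v x y _ vI xI yI]; first exact: subsetT.
  have vI' : v \in ~: I by rewrite inE.
  case/orP: (h v vI') => /forall_inP k; first by rewrite !k.
  by move: (k _ xI) (k _ yI); do 2 case: (G v _).
rewrite inE => vI; have [-> | [x xI]] := set_0Vmem I.
  by apply/orP; left; apply/forall_inP => x; rewrite inE.
case Evx: (G v x); apply/orP; [left | right]; apply/forall_inP => y yI.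
  by rewrite (h v y x) ?inE.
by rewrite (h v y x) ?inE ?Evx.
Qed.

Lemma indecomposableP :
  reflect (forall I, interval_of setT I -> #|I| <= 1 \/ I = setT)
          (indecomposable G).
Proof.
apply: (iffP forallP) => h I.
  move=> hI; have := implyP (h I) (introT (intervalP I) hI).
  case/or3P=> [/eqP->|/eqP->|/existsP[x /eqP->]]; last by left; rewrite cards1.
    by left; rewrite cards0.
  by right.
apply/implyP=> /intervalP/h[|->]; last by rewrite /trivial_interval eqxx orbT.
rewrite leq_eqVlt ltnS leqn0 cards_eq0 => /orP[/cards1P[x ->]|I0].
  by apply/or3P; constructor 3; apply/existsP; exists x.
by apply/or3P; constructor 1.
Qed.

End Intervals.

(** * Attachments of outer vertices to an indecomposable set *)

Section Indecomposable.
Variables (V : finType) (G : sgraph V).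
Implicit Types (X Y S I : {set V}) (B : option V) (t : option V * bool) (x y u v : V).

Local Notation interval_of := (interval_of G).

Definition indec X := indecomposable (induced G X).

(** Indecomposability of an induced subgraph is moved to subsets of [V], so that sets can grow and
    shrink without transport between sigma types. *)
Lemma indecP X :
  reflect (forall I, interval_of X I -> #|I| <= 1 \/ I = X) (indec X).
Proof.
apply: (iffP (indecomposableP _)) => h.
  move=> I [IX hI]; pose J : {set {x | x \in X}} := val @^-1: I.
  have IJ : I = val @: J.
    apply/setP=> x; apply/idP/imsetP => [xI | [y]]; last by rewrite inE => ? ->.
    by exists (Sub x (subsetP IX x xI)); rewrite ?inE ?SubK.
  have [|J1|JT] := h J; last 2 first.
  - by left; rewrite IJ card_imset //; apply: val_inj.
  - right; rewrite IJ JT; apply/setP=> x; apply/imsetP/idP => [[y _ ->]|xX].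
      exact: valP.
    by exists (Sub x xX); rewrite ?inE ?SubK.
  split=> [|v x y _]; first exact: subsetT.
  by rewrite !inE /= /induced_adj => vI xI yI; apply: hI => //; apply: valP.
move=> J [_ hJ]; have [|J1|JX] := h (val @: J); last 2 first.
- by left; rewrite -(card_imset (mem J) val_inj).
- right; apply/setP=> x; rewrite inE; have : val x \in val @: J.
    by rewrite JX; apply: valP.
  by case/imsetP=> y yJ /val_inj->.
split; first by apply/subsetP=> _ /imsetP[y _ ->]; apply: valP.
move=> v _ _ vX vJ /imsetP[x xJ ->] /imsetP[y yJ ->].
apply: (hJ (Sub v vX)) => //; apply: contra vJ => vJ.
by apply/imsetP; exists (Sub v vX).
Qed.

Lemma indecNP X :
  reflect (exists2 I, interval_of X I & 1 < #|I| /\ I != X) (~~ indec X).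
Proof.
apply: (iffP idP) => [|[I hI [I1 IX]]]; last first.
  by apply/negP=> /indecP/(_ I hI)[|/eqP]; [rewrite leqNgt I1 | apply/negP].
move=> nX; have : [exists I : {set V}, [&& I \subset X,
   [forall v in X :\: I, forall x in I, forall y in I, G v x == G v y],
   1 < #|I| & I != X]].
  apply: contraR nX; rewrite negb_exists => /forallP h; apply/indecP=> I [IX hI].
  have := h I; rewrite IX /=; case: leqP => [|I1 /=]; first by left.
  rewrite negb_and negbK => /orP[|/eqP]; last by right.
  case/negP; apply/forall_inP=> v /setDP[vX vI].
  by do 2 (apply/forall_inP=> ? ?); apply/eqP/hI.
case/existsP=> I /and4P[IX /forall_inP hI I1 InX]; exists I => //; split=> //.
move=> v x y vX vI xI yI; have /hI/forall_inP/(_ _ xI)/forall_inP/(_ _ yI)/eqP// : v \in X :\: I.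
by rewrite inE vX vI.
Qed.

Lemma setU_pair X x y : X :|: [set x; y] = x |: (y |: X).
Proof. by apply/setP=> z; rewrite !inE orbC orbA. Qed.

Lemma indecT : indec setT = indecomposable G.
Proof. exact/indecP/indecomposableP. Qed.

(* An attachment (Some u, b) describes a vertex with the same neighbours in X
   as u, joined to u iff b; (None, b) describes a vertex joined to all of X
   if b, to none if not b. The first component is called the block. *)
Definition row (t : option V * bool) x : bool :=
  if t.1 is Some u then if x == u then t.2 else G u x else t.2.

Definition block_in X (B : option V) := if B is Some u then u \in X else true.

Definition typed X t v :=
  [&& v \notin X, block_in X t.1 & [forall x in X, G v x == row t x]].

Lemma typedP X t v :
  reflect [/\ v \notin X, block_in X t.1 & {in X, forall x, G v x = row t x}]
          (typed X t v).
Proof.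
apply: (iffP and3P) => [] [vX tX /= h]; split=> //.
  by move=> x xX; apply/eqP; apply: (forall_inP h).
by apply/forall_inP => x xX; apply/eqP/h.
Qed.

Lemma card_le1_eq I x y : #|I| <= 1 -> x \in I -> y \in I -> x = y.
Proof. by move=> /card_le1_eqP h xI yI; apply: h. Qed.

Lemma card_gt1_ex I : 1 < #|I| -> exists x y, [/\ x \in I, y \in I & x != y].
Proof. by case/card_gt1P=> x [y [xI yI xy]]; exists x, y. Qed.

Lemma card_gt1_in I x y : x \in I -> y \in I -> x != y -> 1 < #|I|.
Proof. by move=> xI yI xy; apply/card_gt1P; exists x, y. Qed.

Lemma neq_mem I x y : x \in I -> y \notin I -> x != y.
Proof. by move=> xI; apply: contraNneq => <-. Qed.

(** Different attachments with equal rows would give [X] a nontrivial interval: {u, u'} for two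
    blocks, [X :\ u] for a block and a constant. *)
Lemma row_inj X t t' : indec X -> 2 < #|X| -> block_in X t.1 ->
  block_in X t'.1 -> {in X, row t =1 row t'} -> t = t'.
Proof.
move=> iX X3; have noneN u b b' : u \in X ->
    ~ {in X, row (None, b) =1 row (Some u, b')}.
  move=> uX h; have := elimT (indecP X) iX (X :\ u); case.
  - split=> [|v x y vX]; first exact: subsetDl.
    rewrite !inE vX andbT negbK => /eqP-> /andP[xu xX] /andP[yu yX].
    by have := h x xX; have := h y yX; rewrite /row /= (negPf xu) (negPf yu) => <- <-.
  - by move: X3; rewrite (cardsD1 u) uX add1n ltnS ltnNge => /negPf->.
  by move/setP/(_ u); rewrite !inE eqxx uX.
case: t t' => [[u|] b] [[u'|] b'] //= uX u'X h.
- case: (eqVneq u u') => [uu|uu].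
    by move: (h u uX); rewrite -uu /row /= eqxx => ->.
  have := elimT (indecP X) iX [set u; u']; case.
  - split=> [|v x y vX]; first by apply/subsetP=> z /set2P[]->.
    rewrite !inE negb_or => /andP[vu vu'].
    have := h v vX; rewrite /row /= (negPf vu) (negPf vu').
    rewrite ![G v _]adj_sym => E /orP[]/eqP-> /orP[]/eqP->; done.
  - by rewrite cards2 uu.
  by move=> E; move: X3; rewrite -E cards2 uu.
- by case: (noneN u b' b uX) => x xX; rewrite h.
- by case: (noneN u' b b' u'X).
have /card_gt0P[x xX] : 0 < #|X| by apply: leq_trans X3.
by move: (h x xX); rewrite /row /= => ->.
Qed.

Lemma typed_inj X t t' v : indec X -> 2 < #|X| -> typed X t v ->
  typed X t' v -> t = t'.
Proof.
move=> iX X3 /typedP[_ tX h] /typedP[_ t'X h'].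
by apply: (row_inj iX X3 tX t'X) => x xX; rewrite -h // h'.
Qed.

Lemma interval_of_sub X Y I : Y \subset X -> interval_of X I ->
  interval_of Y (I :&: Y).
Proof.
move=> YX [IX h]; split=> [|v x y vY]; first exact: subsetIr.
rewrite !inE vY andbT => vI /andP[xI _] /andP[yI _].
by apply: h => //; apply: (subsetP YX).
Qed.

(** A nontrivial interval of [v |: X] has a trivial trace on [X]. Without v it is [X] itself and v
    is constant on [X]; with v it is {u, v}. *)
Lemma typed_of_decomposable X v : indec X -> v \notin X ->
  ~~ indec (v |: X) -> exists t, typed X t v.
Proof.
move=> iX vX /indecNP[I hI [I1 IX]].
have XvX : X \subset v |: X by apply: subsetUr.
have := interval_of_sub XvX hI; case: hI => IvX hI hIX.
have sub x : x \in I -> x = v \/ x \in X.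
  by move/(subsetP IvX); rewrite !inE => /orP[/eqP|]; [left | right].
have [vI | vI] := boolP (v \in I); last first.
  have IiX : I :&: X = I.
    apply/setIidPl/subsetP=> x xI; case: (sub x xI) => // E.
    by move: vI; rewrite -E xI.
  case: (elimT (indecP X) iX _ hIX); rewrite IiX; first by rewrite leqNgt I1.
  move=> IeX; case: (card_gt1_ex I1) => x [y [xI yI _]].
  exists (None, G v x); apply/typedP; split=> // z zX.
  by apply: hI; rewrite ?inE ?eqxx ?IeX // -IeX.
case: (elimT (indecP X) iX _ hIX) => [I1' | E]; last first.
  case/eqP: IX; apply/setP=> x; rewrite !inE.
  case: (eqVneq x v) => [-> // | xv] /=; move/setP/(_ x): E; rewrite inE.
  case: (boolP (x \in X)) => xX; rewrite ?andbT // => _.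
  by apply/negP=> /sub[] // /eqP; rewrite ?(negPf xv) ?(negPf xX).
have [u uI uX] : exists2 u, u \in I & u \in X.
  case: (card_gt1_ex I1) => x [y [xI yI xy]].
  case: (sub x xI) => [xv|]; last by exists x.
  case: (sub y yI) => [yv|]; last by exists y.
  by move: xy; rewrite xv yv eqxx.
exists (Some u, G v u); apply/typedP; split=> // x xX; rewrite /row /=.
case: (eqVneq x u) => [-> // | xu].
rewrite ![G _ x]adj_sym; apply: hI => //; first by rewrite !inE xX orbT.
apply: contra xu => xI; apply/eqP; apply: card_le1_eq I1' _ _; exact/setIP.
Qed.

Lemma row_notin X t y : y \notin X -> block_in X t.1 ->
  row t y = if t.1 is Some u then G u y else t.2.
Proof. by rewrite /row; case: t => [[u|] b] //= yX uX; case: eqP uX yX => // -> ->. Qed.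

(* If every vertex of S looks to all the vertices outside S as its attachment
   to X prescribes, then u |: S or Y :\: S is a nontrivial interval. *)
Lemma follow_class_decomposable X Y B S : 1 < #|X| -> X \subset Y ->
  S \subset Y -> S != set0 ->
  {in S, forall c, exists2 b, typed X (B, b) c &
     forall w, w \in Y -> w \notin X -> w \notin S -> G c w = row (B, b) w} ->
  ~~ indec Y.
Proof.
move=> X1 XY SY /set0Pn[x xS] hS; apply/indecNP.
case: (card_gt1_ex X1) => a [b [aX bX ab]].
have SX w : w \in S -> w \notin X by case/hS=> s /typedP[].
have out c : c \in S -> exists s,
    forall v, v \in Y -> v \notin S -> G c v = row (B, s) v.
  case/hS=> s /typedP[cX BX h] h'; exists s => v vY vS.
  by case: (boolP (v \in X)) => vX; [apply: h | apply: h'].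
have [s /typedP[_ BX _] _] := hS x xS.
case: B BX hS out => [u|] /= uX hS out.
  have uS : u \notin S by apply: contraL uX => /SX.
  exists (u |: S); last first.
    split; first by rewrite cardsU1 uS ltnS; apply/card_gt0P; exists x.
    have [c cX cu] : exists2 c, c \in X & c != u.
      case: (eqVneq a u) => [E | ]; last by exists a.
      by exists b => //; rewrite -E eq_sym.
    apply/negP=> /eqP/setP/(_ c); rewrite in_setU1 (negPf cu) (subsetP XY _ cX).
    by move/SX; rewrite cX.
  split=> [|v p q vY].
    by apply/subsetP=> z /setU1P[->|/(subsetP SY)//]; apply: (subsetP XY).
  rewrite !in_setU1 negb_or => /andP[vu vS].
  have k p' : (p' == u) || (p' \in S) -> G v p' = G v u.
    case/orP=> [/eqP-> //|/out[r h]].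
    by rewrite ![G v _]adj_sym h // /row /= (negPf vu).
  by move=> /k-> /k->.
have XYS : X \subset Y :\: S.
  rewrite subsetD XY; apply/pred0P=> z /=.
  by case: (boolP (z \in S)) => [/SX/negPf->|]; rewrite ?andbF.
exists (Y :\: S); last first.
  split; first exact: leq_trans X1 (subset_leq_card XYS).
  by apply/negP=> /eqP/setP/(_ x); rewrite in_setD xS (subsetP SY _ xS).
split=> [|v p q vY]; first exact: subsetDl.
rewrite !in_setD vY andbT negbK => /out[r h] /andP[pS pY] /andP[qS qY].
by rewrite !h.
Qed.

Lemma follow_decomposable X t x y : 1 < #|X| -> typed X t x -> y \notin X ->
  x != y -> G x y = row t y -> ~~ indec (X :|: [set x; y]).
Proof.
move=> X1 xt yX xy E.
apply: (@follow_class_decomposable X _ t.1 [set x]) => //.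
- exact: subsetUl.
- by apply/subsetP=> z /set1P->; rewrite !inE eqxx orbT.
- by apply/set0Pn; exists x; rewrite inE.
move=> _ /set1P->; exists t.2; rewrite -surjective_pairing // => w.
by rewrite !inE => /or3P[->|/eqP->|/eqP->] //; rewrite eqxx.
Qed.

(** Whether x and y are adjacent does not matter: {u, x, y}, or [X] when there is no block, is an
    interval. *)
Lemma same_block_decomposable X t t' x y : 1 < #|X| -> typed X t x ->
  typed X t' y -> t.1 = t'.1 -> ~~ indec (X :|: [set x; y]).
Proof.
move=> X1 xt yt' tt'.
apply: (@follow_class_decomposable X _ t.1 [set x; y]) => //.
- exact: subsetUl.
- exact: subsetUr.
- by apply/set0Pn; exists x; rewrite !inE eqxx.
move=> c cxy; exists (if c == x then t.2 else t'.2); last first.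
  by move=> w; rewrite !inE => /or3P[->|->|->] //; rewrite ?orbT.
case: eqP => [->|/eqP]; first by rewrite -surjective_pairing.
by case/set2P: cxy => ->; rewrite ?eqxx // tt' -surjective_pairing.
Qed.

(** Converse of [follow_decomposable]. The condition on y also allows a y without any attachment,
    which is the situation met in the proof of [indec_add_pair]. *)
Lemma decomposable_follow X t x y : indec X -> 2 < #|X| -> typed X t x ->
  y \notin X -> x != y -> (forall t', typed X t' y -> t'.1 != t.1) ->
  ~~ indec (X :|: [set x; y]) -> G x y = row t y.
Proof.
move=> iX X3 xt yX xy ynt; have := xt; case/typedP=> xX tX h.
rewrite (row_notin yX tX) => nXxy.
(* If [y |: X] is indecomposable, x is attached to it. The block cannot be y, since y would then
   share the block of x, so this attachment is [t] by [row_inj]. *)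
have [iXy | nXy] := boolP (indec (y |: X)).
  rewrite setU_pair in nXxy.
  have xXy : x \notin y |: X by rewrite !inE negb_or xy.
  have [[B b] /typedP[_ BX h']] := typed_of_decomposable iXy xXy nXxy.
  have hX z : z \in X -> row t z = row (B, b) z.
    by move=> zX; rewrite -h // h' // !inE zX orbT.
  case: (eqVneq B (Some y)) => [EB | BY].
    have /ynt/negP[] : typed X (t.1, (if t.1 is Some u then G y u else t.2)) y.
      apply/typedP; split=> // z zX.
      have : G y z = row t z.
        by rewrite hX // /row EB /=; case: eqP => // zy; move: yX; rewrite -zy zX.
      by move: tX; rewrite /row; case: (t) => [[u|] s] //= uX; case: eqP => [->|].
    by [].
  have BX' : block_in X (B, b).1.
    rewrite /=; case: B BX BY {h' hX} => [w|] //=; rewrite !inE; case: eqP => //= -> _.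
    by rewrite eqxx.
  have E : t = (B, b) by apply: row_inj iX X3 tX _ hX.
  by rewrite (h' y) ?inE ?eqxx // (row_notin yX BX') E.
have [t' yt'] := typed_of_decomposable iX yX nXy.
have := ynt t' yt'; case/typedP: (yt') => _ t'X h' bt.
case/indecNP: nXxy => I hI [I1 IX].
have XX : X \subset X :|: [set x; y] by apply: subsetUl.
have := interval_of_sub XX hI; case: hI => IXX hI hIX.
have sub z : z \in I -> [\/ z = x, z = y | z \in X].
  by move/(subsetP IXX); rewrite !inE => /or3P[|/eqP|/eqP];
   [constructor 3 | constructor 1 | constructor 2].
have inx : x \in X :|: [set x; y] by rewrite !inE eqxx orbT.
have iny : y \in X :|: [set x; y] by rewrite !inE eqxx !orbT.
have inX z : z \in X -> z \in X :|: [set x; y] by rewrite !inE => ->.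
have twin u w : w \notin X -> u \in X -> I :&: X = [set u] -> w \in I ->
    typed X (Some u, G w u) w.
  move=> wX uX E wI; apply/typedP; split=> // z zX; rewrite /row /=.
  case: (eqVneq z u) => [-> // | zu].
  have zI : z \notin I.
    by apply: contra zu => zI; have : z \in I :&: X by [apply/setIP]; rewrite E inE.
  have uI : u \in I by move/setP/(_ u): E; rewrite !inE eqxx => /andP[].
  by rewrite ![G _ z]adj_sym; apply: hI => //; apply: inX.
(* The trace of [I] on [X] is trivial: all of [X] here, empty or a single vertex u below. *)
case: (elimT (indecP X) iX _ hIX) => [I1' | IeX]; last first.
  have sXI z : z \in X -> z \in I by rewrite -{1}IeX => /setIP[].
  have /card_gt0P[a aX] : 0 < #|X| by apply: leq_trans X3.
  have [xI | xI] := boolP (x \in I); last first.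
    have xN : typed X (None, G x a) x.
      by apply/typedP; split=> // z zX; apply: hI => //; apply: sXI.
    have Et := typed_inj iX X3 xt xN; rewrite Et.
    have [yI | yI] := boolP (y \in I); first by apply: hI => //; apply: sXI.
    have yN : typed X (None, G y a) y.
      by apply/typedP; split=> // z zX; apply: hI => //; apply: sXI.
    by move: bt; rewrite Et (typed_inj iX X3 yt' yN) eqxx.
  have yI : y \notin I.
    apply: contra IX => yI; rewrite eqEsubset IXX /=; apply/subsetP=> z.
    by rewrite !inE => /or3P[/sXI|/eqP->|/eqP->].
  have yN : typed X (None, G y a) y.
    by apply/typedP; split=> // z zX; apply: hI => //; apply: sXI.
  move: bt; rewrite (typed_inj iX X3 yt' yN) /=.
  case: (t) tX => [[u|] s] //= uX _; rewrite ![G _ y]adj_sym.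
  by apply: hI => //; apply: sXI.
have [I0 | [u uI]] := set_0Vmem (I :&: X).
  have [xI yI] : x \in I /\ y \in I.
    have NX z : z \in I -> z \notin X.
      by move=> zI; apply/negP=> zX; move/setP/(_ z): I0; rewrite !inE zI zX.
    case: (card_gt1_ex I1) => p [q [pI qI pq]].
    case: (sub p pI) (NX p pI) => [E|E|->] // _;
    case: (sub q qI) (NX q qI) => [E'|E'|->] // _; move: pI qI pq;
    by rewrite ?E ?E' ?eqxx.
  have yt : typed X t y.
    apply/typedP; split=> // z zX; rewrite -h // ![G _ z]adj_sym.
    apply: hI => //; first exact: inX.
    by apply/negP=> zI; move/setP/(_ z): I0; rewrite !inE zI zX.
  by move: (ynt t yt); rewrite eqxx.
case/setIP: uI => uI uX.
have EI : I :&: X = [set u].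
  apply/setP=> z; rewrite [RHS]inE; apply/idP/eqP => [zI|->]; last exact/setIP.
  by apply: card_le1_eq I1' _ _ => //; apply/setIP.
(* Whichever of x and y lies in [I] is attached to u. Both cannot, as their blocks differ. *)
have [xI | xI] := boolP (x \in I).
  have Et := typed_inj iX X3 xt (twin u x xX uX EI xI).
  have [yI | yI] := boolP (y \in I).
    by move: bt; rewrite Et (typed_inj iX X3 yt' (twin u y yX uX EI yI)) eqxx.
  by rewrite Et /= ![G _ y]adj_sym; apply: hI.
have yI : y \in I.
  case: (card_gt1_ex I1) => p [q [pI qI pq]].
  have [z zI zu] : exists2 z, z \in I & z != u.
    case: (eqVneq p u) => [E | ]; last by exists p.
    by exists q => //; rewrite -E eq_sym.
  case: (sub z zI) => [E|<- //|zX]; first by move: xI; rewrite -E zI.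
  have : z \in I :&: X by apply/setIP.
  by rewrite EI inE (negPf zu).
have Et' := typed_inj iX X3 yt' (twin u y yX uX EI yI).
have -> : G x y = G x u by apply: hI.
rewrite h // /row; case: (t) tX bt => [[w|] s] //= wX; rewrite Et' /= => bt.
have wu : w != u by apply: contraNneq bt => ->.
rewrite eq_sym (negPf wu); apply: hI => //; first exact: inX.
by apply: contra wu => wI; apply/eqP; apply: card_le1_eq I1' _ _; apply/setIP.
Qed.

End Indecomposable.

(** * Growing indecomposable sets by pairs *)

Section Extension.
Variables (V : finType) (G : sgraph V).
Implicit Types (X Y I : {set V}) (t : option V * bool) (x y u v : V).

Local Notation interval_of := (interval_of G).
Local Notation indec := (indec G).
Local Notation typed := (typed G).
Local Notation row := (row G).

Lemma typed_sub X Y t v : X \subset Y -> typed Y t v -> block_in X t.1 ->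
  typed X t v.
Proof.
move=> XY /typedP[vY _ h] tX; apply/typedP; split=> //.
  by apply: contra vY; apply: (subsetP XY).
by move=> z zX; apply: h; apply: (subsetP XY).
Qed.

(* Ehrenfeucht and Rozenberg. *)
Lemma indec_add_pair X : indec setT -> indec X -> 2 < #|X| -> 1 < #|~: X| ->
  exists x y, [/\ x \notin X, y \notin X, x != y & indec (X :|: [set x; y])].
Proof.
move=> iT iX X3 CX1.
have [h | h] := boolP [exists x, [exists y, [&& x \notin X, y \notin X, x != y
   & indec (X :|: [set x; y])]]].
  case/existsP: h => x /existsP[y /and4P[]]; exists x, y; split=> //.
have {h}nXxy x y : x \notin X -> y \notin X -> x != y ->
    ~~ indec (X :|: [set x; y]).
  move=> xX yX xy; apply: contra h => h; apply/existsP; exists x.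
  by apply/existsP; exists y; apply/and4P.
have triv I : interval_of setT I -> 1 < #|I| -> I = setT.
  by move=> /(elimT (indecP _ _) iT)[|//]; rewrite ltnNge => ->.
(* If every pair is decomposable, all vertices sharing a block follow their attachments outside
   their class, by [decomposable_follow]; the class would then decompose G. *)
have ntyped t x : ~ typed X t x.
  move=> xt; have [xX tX _] := typedP _ _ _ _ xt.
  pose C := [set w | [exists b, typed X (t.1, b) w]].
  have CP w : w \in C -> exists b, typed X (t.1, b) w.
    by rewrite inE => /existsP.
  have xC : x \in C.
    by rewrite inE; apply/existsP; exists t.2; rewrite -surjective_pairing.
  have CX w : w \in C -> w \notin X by case/CP=> b /typedP[].
  have out z b y : typed X (t.1, b) z -> y \notin X -> y \notin C ->
      G z y = row (t.1, b) y.
    move=> zb yX yC; have [zX _ _] := typedP _ _ _ _ zb.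
    have zC : z \in C by rewrite inE; apply/existsP; exists b.
    apply: (decomposable_follow iX) => //; first exact: neq_mem zC yC.
      move=> [B' b'] yt'; apply: contra yC => /eqP /= E; rewrite inE.
      by apply/existsP; exists b'; rewrite -E.
    by apply: nXxy => //; exact: neq_mem zC yC.
  suff /negP[] : ~~ indec setT by [].
  apply: (@follow_class_decomposable _ _ X _ t.1 C) => //; first exact: ltnW.
    by apply/set0Pn; exists x.
  by move=> c cC; have [b cb] := CP c cC; exists b => // w _; apply: out.
(* As no vertex is attached to [X], each [p |: X] is indecomposable, and an attachment of q to it
   can only have block p. So all outer vertices look alike to [X]. *)
have hI : interval_of setT (~: X).
  split=> [|v p q _]; first exact: subsetT.
  rewrite !inE negbK => vX pX qX; case: (eqVneq p q) => [-> // | pq].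
  have ip : indec (p |: X).
    have [//|n] := boolP (indec (p |: X)).
    by have [t /ntyped] := typed_of_decomposable iX pX n.
  have [] := @typed_of_decomposable _ G (p |: X) q ip.
  - by rewrite !inE negb_or eq_sym pq.
  - by rewrite -setU_pair; apply: nXxy; rewrite // eq_sym.
  move=> t qt; case: (boolP (block_in X t.1)) => [tX | tX].
    by case: (ntyped t q); apply: (typed_sub _ qt tX); apply: subsetUr.
  have [_ + h] := typedP _ _ _ _ qt.
  case: t tX h {qt} => [[u|] b] //= uX h; rewrite !inE (negPf uX) orbF => /eqP up.
  rewrite ![G v _]adj_sym h ?inE ?vX ?orbT // /row /= up.
  by rewrite (negPf (neq_mem vX pX)).
have /setP h := triv _ hI CX1.
have /card_gt0P[a aX] : 0 < #|X| by apply: leq_trans X3.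
by have := h a; rewrite !inE aX.
Qed.

(** Each use of [indec_add_pair] takes two vertices from the complement; an even complement
    therefore reaches size exactly 2. *)
Lemma indec_del_pair X : indec setT -> indec X -> 2 < #|X| -> 1 < #|~: X| ->
  ~~ odd #|~: X| ->
  exists x y, [/\ x \notin X, y \notin X, x != y & indec (~: [set x; y])].
Proof.
move=> iT; have [k] := ubnP #|~: X|; elim: k X => // k IH X kX iX X3 CX1 CXo.
have [x [y [xX yX xy ixy]]] := indec_add_pair iT iX X3 CX1.
have cxy : #|~: (X :|: [set x; y])| + 2 = #|~: X|.
  have <- : #|[set x; y]| = 2 by rewrite cards2 xy.
  rewrite setCU -setDE addnC -[RHS](cardsID [set x; y]); congr (#|(_ : {set V})| + _).
  by apply/esym/setIidPr; apply/subsetP=> z /set2P[]->; rewrite inE.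
have [C1 | C1] := ltnP 1 #|~: (X :|: [set x; y])|.
  case: (IH _ _ ixy) => // [|||p [q [pX qX pq i]]]; try by lia.
    by apply: leq_trans X3 _; apply: subset_leq_card; apply: subsetUl.
  exists p, q; split=> //; [move: pX | move: qX];
  by apply: contra => h; rewrite inE h.
case: (leqP #|~: X| 2) => [le2 | gt2]; last by lia.
exists x, y; split=> //; rewrite (_ : ~: [set x; y] = X) //.
apply: setC_inj; rewrite setCK; apply/eqP; rewrite eqEcard cards2 xy.
by rewrite le2 andbT; apply/subsetP=> z /set2P[]->; rewrite inE.
Qed.

End Extension.

(** * Exhaustive check of the graphs on five vertices *)

Fixpoint bitseqs n : seq (seq bool) :=
  if n is n'.+1 then
    [seq true :: s | s <- bitseqs n'] ++ [seq false :: s | s <- bitseqs n']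
  else [:: [::]].

Lemma mem_bitseqs s : s \in bitseqs (size s).
Proof.
elim: s => // b s IH; rewrite /= mem_cat; apply/orP.
by case: b; [left | right]; apply: map_f.
Qed.

Section FiveVertices.

Definition edge_code (e : nat -> nat -> bool) : seq bool :=
  [seq e p.1 p.2 | p <- [:: (0, 1); (0, 2); (0, 3); (0, 4); (1, 2); (1, 3);
                            (1, 4); (2, 3); (2, 4); (3, 4)]].

Definition adjacency_table (s : seq bool) : seq (seq bool) :=
  if s is [:: a; b; c; d; e; f; g; h; i; j] then
    [:: [:: false; a; b; c; d]; [:: a; false; e; f; g]; [:: b; e; false; h; i];
        [:: c; f; h; false; j]; [:: d; g; i; j; false]]
  else [::].

Definition decode (s : seq bool) : nat -> nat -> bool :=
  let t := adjacency_table s in fun i j => nth false (nth [::] t i) j.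

Let r5 := iota 0 5.

(** The last conjunct excludes closed walks of length 5. A triangle carries such a walk as well, so
    on five vertices it amounts to being bipartite. *)
Definition five_cond (e : nat -> nat -> bool) : bool :=
  [&& all (fun i => has (e i) r5) r5,
      all (fun i => all (fun j =>
        (i == j) || has (fun k => e i k != e j k) r5) r5) r5 &
      all (fun i => all (fun j => e i j ==> all (fun k => e j k ==>
        all (fun l => e k l ==> all (fun m => e l m ==> ~~ e m i) r5)
          r5) r5) r5) r5].

Definition path_order (e : nat -> nat -> bool) (p : seq nat) : bool :=
  all (fun i => all (fun j =>
    e (nth 0 p i) (nth 0 p j) == path_rel i j) r5) r5.

(** Behind the computation: with classes of sizes 2 and 3, the three vertices have distinct nonempty
    neighbourhoods {a}, {b}, {a, b}, which is a path; less balanced classes force isolated vertices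
    or twins. *)
Lemma five_check : all (fun s => let e := decode s in five_cond e ==>
  has (path_order e) (permutations r5)) (bitseqs 10).
Proof. by vm_compute. Qed.

Lemma decode_edge_code (e : nat -> nat -> bool) i j :
  symmetric e -> irreflexive e -> i < 5 -> j < 5 ->
  decode (edge_code e) i j = e i j.
Proof.
move=> es ei; case: i => [|[|[|[|[|//]]]]] _; case: j => [|[|[|[|[|//]]]]] _;
  by rewrite /decode /= ?ei //= es.
Qed.

Lemma five_path (e : rel 'I_5) : symmetric e -> irreflexive e ->
  (forall i, exists j, e i j) ->
  (forall i j, i != j -> exists k, e i k != e j k) ->
  (forall i j k l m, e i j -> e j k -> e k l -> e l m -> ~~ e m i) ->
  exists2 p : 'I_5 -> 'I_5, injective p &
    forall i j, e (p i) (p j) = path_rel i j.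
Proof.
move=> es ei e1 e2 e3; pose e' i j := e (inord i) (inord j).
have dE i j : i < 5 -> j < 5 -> decode (edge_code e') i j = e' i j.
  by apply: decode_edge_code => [x y|x]; [apply: es | apply: ei].
have r5P i : i \in r5 -> i < 5 by rewrite mem_iota.
have r5I (i : 'I_5) : nat_of_ord i \in r5 by rewrite mem_iota ltn_ord.
have mE : edge_code e' \in bitseqs 10 by exact: (mem_bitseqs (edge_code e')).
set d := decode _ in dE.
have /implyP h : five_cond d ==> has (path_order d) (permutations r5).
  exact: (allP five_check _ mE).
have dI (i j : 'I_5) : d i j = e i j by rewrite dE // /e' !inord_val.
have {}h : has (path_order d) (permutations r5).
  apply: h.
    apply/and3P; split.
    - apply/allP=> i /r5P i5; apply/hasP; have [j ij] := e1 (inord i).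
      by exists (nat_of_ord j) => //; rewrite dE // /e' inord_val.
    - apply/allP=> i /r5P i5; apply/allP=> j /r5P j5.
      apply/orP; case: (eqVneq i j) => [|ij]; [by left | right].
      have [|k hk] := e2 (inord i) (inord j).
        by apply: contra ij => /eqP/(congr1 val); rewrite /= !inordK // => ->.
      by apply/hasP; exists (nat_of_ord k) => //; rewrite !dE // /e' inord_val.
    apply/allP=> i /r5P i5; apply/allP=> j /r5P j5; rewrite dE //.
    apply/implyP=> ij; apply/allP=> k /r5P k5; rewrite dE //.
    apply/implyP=> jk; apply/allP=> l /r5P l5; rewrite dE //.
    apply/implyP=> kl; apply/allP=> m /r5P m5; rewrite !dE //.
    by apply/implyP=> lm; apply: e3 ij jk kl lm.
case/hasP: h => p; rewrite mem_permutations => pp /allP hp.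
have sp : size p = 5 by rewrite (perm_size pp).
have p5 (i : 'I_5) : nth 0 p i < 5.
  by apply: r5P; rewrite -(perm_mem pp) mem_nth // sp.
exists (fun i => Ordinal (p5 i)) => [i j [] /eqP|i j].
  by rewrite nth_uniq ?sp // ?(perm_uniq pp) ?iota_uniq // => /eqP/val_inj.
by rewrite -dI /=; apply/eqP; apply: (allP (hp _ (r5I i)) _ (r5I j)).
Qed.

End FiveVertices.

(** * The outer vertices form a path *)

Section PathExtension.
Variables (V : finType) (G : sgraph V).
Implicit Types (X Y S I : {set V}) (t : option V * bool) (x y u v : V).

Local Notation indec := (indec G).
Local Notation typed := (typed G).
Local Notation row := (row G).

(* The vertices outside X form a path f 0 - ... - f 4 of G_X, they are attached
   alternately by t0 and t1, and an edge of G_X is a pair on which G deviates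
   from what these attachments prescribe. *)
Definition path_extension X t0 t1 (f : 'I_5 -> V) : Prop :=
  let t (i : 'I_5) := if odd i then t1 else t0 in
  [/\ injective f, f @: 'I_5 = ~: X, t0.1 != t1.1,
      forall i, typed X (t i) (f i) &
      forall i j : 'I_5, i != j ->
        G (f i) (f j) = path_rel i j (+) row (t i) (f j)].

Section Existence.
Variable X : {set V}.
Hypotheses (iT : indec setT) (iX : indec X) (X3 : 2 < #|X|) (CX5 : #|~: X| = 5).
Hypothesis nI : forall x y, x \notin X -> y \notin X -> x != y ->
  ~~ indec (~: [set x; y]).

Let E x y := indec (X :|: [set x; y]).

(** The default is never taken outside [X]: by [nI1] every outer vertex has an attachment. *)
Let tau x := odflt (None, false) [pick t | typed X t x].

Let X2 : 1 < #|X|. Proof. exact: ltnW. Qed.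

Let nI1 x : x \notin X -> ~~ indec (x |: X).
Proof.
move=> xX; apply/negP=> ix.
have c4 : #|~: (x |: X)| = 4.
  by apply/eqP; rewrite -(eqn_add2l #|x |: X|) cardsC -(cardsC X) cardsU1 xX CX5 addnAC addnC.
have [|||p [q [pX qX pq i]]] := indec_del_pair iT ix.
- by apply: leq_trans X3 _; rewrite cardsU1 leq_addl.
- by rewrite c4.
- by rewrite c4.
move: pX qX; rewrite !in_setU1 !negb_or => /andP[_ pX] /andP[_ qX].
by have /negP[] := nI pX qX pq.
Qed.

Let tauP x : x \notin X -> typed X (tau x) x.
Proof.
move=> xX; rewrite /tau; case: pickP => //= h.
by have [t] := typed_of_decomposable iX xX (nI1 xX); rewrite h.
Qed.

Let tau_unique t x : typed X t x -> tau x = t.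
Proof.
move=> xt; have [xX _ _] := typedP _ _ _ _ xt.
exact: typed_inj iX X3 (tauP xX) xt.
Qed.

Let Esym x y : E x y = E y x.
Proof. by rewrite /E [[set x; y]]setUC. Qed.

Let Eirr x : x \notin X -> E x x = false.
Proof. by move=> xX; apply/negbTE; rewrite /E setUid setUC nI1. Qed.

Let E_block x y : x \notin X -> y \notin X -> E x y -> (tau x).1 != (tau y).1.
Proof.
move=> xX yX; apply: contraTneq.
exact: same_block_decomposable X2 (tauP xX) (tauP yX).
Qed.

Let E_neq x y : x \notin X -> E x y -> x != y.
Proof. by move=> xX; apply: contraTneq => <-; rewrite Eirr. Qed.

Let block_neq x y : (tau x).1 != (tau y).1 -> x != y.
Proof. by apply: contraNneq => ->. Qed.

Let E_row x y : x \notin X -> y \notin X -> (tau x).1 != (tau y).1 ->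
  G x y = E x y (+) row (tau x) y.
Proof.
move=> xX yX b; case e: (E x y) => /=.
  have : G x y != row (tau x) y; last by case: (G x y); case: row.
  apply: contraTneq e; apply: follow_decomposable (tauP xX) yX _ => //.
  exact: block_neq.
apply: decomposable_follow (tauP xX) yX _ _ _ => //; first exact: block_neq.
  by move=> t /tau_unique <-; rewrite eq_sym.
by apply/negbT.
Qed.

Let nI3 x y z : x \notin X -> y \notin X -> z \notin X -> E x y -> z != x ->
  z != y -> ~~ indec (z |: (X :|: [set x; y])).
Proof.
move=> xX yX zX e zx zy; apply/negP=> ixyz.
have xy := E_neq xX e; set Y := z |: _ in ixyz.
have XY : X \subset Y by apply: subset_trans (subsetUr _ _); apply: subsetUl.
have cY : #|~: Y| = 2.
  apply/eqP; rewrite -(eqn_add2l #|Y|) cardsC -(cardsC X) CX5 /Y setU_pair.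
  rewrite !cardsU1 !in_setU1 !negb_or zx zy zX xy xX yX /=.
  by rewrite !add1n !addSn !addnS !addn0.
have [|||p [q [pY qY pq i]]] := indec_del_pair iT ixyz.
- by apply: leq_trans X3 (subset_leq_card XY).
- by rewrite cY.
- by rewrite cY.
have YX u : u \notin Y -> u \notin X by apply: contra; apply: (subsetP XY).
by have /negP[] := nI (YX _ pY) (YX _ qY) pq.
Qed.

(** By [nI3], z is attached to the indecomposable set X + {x, y}. The three cases are: the block is
    in [X] or absent, it is x, it is y. *)
Let star x y z : x \notin X -> y \notin X -> z \notin X -> E x y -> z != x ->
  z != y ->
  [\/ G z x = row (tau z) x /\ G z y = row (tau z) y,
      tau z = tau x /\ G z y = G x y | tau z = tau y /\ G z x = G y x].
Proof.
move=> xX yX zX e zx zy; set Y := X :|: [set x; y].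
have XY : X \subset Y by apply: subsetUl.
have zY : z \notin Y by rewrite !inE !negb_or zX zx.
have [t zt] := typed_of_decomposable e zY (nI3 xX yX zX e zx zy).
have [_ tY h] := typedP _ _ _ _ zt.
have xY : x \in Y by rewrite !inE eqxx orbT.
have yY : y \in Y by rewrite !inE eqxx !orbT.
have xy := E_neq xX e.
have [tX | tX] := boolP (block_in X t.1).
  by rewrite (tau_unique (typed_sub XY zt tX)) !h //; constructor 1.
have twin u w : u \in Y -> w \in Y -> u \notin X -> w != u -> t.1 = Some u ->
    tau z = tau u /\ G z w = G u w.
  move=> uY wY uX wu tu; rewrite h // /row tu (negPf wu); split=> //.
  apply: tau_unique; have [_ uB hu] := typedP _ _ _ _ (tauP uX).
  apply/typedP; split=> // v vX; rewrite -hu // h ?(subsetP XY) // /row tu.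
  by rewrite (negPf (neq_mem vX uX)).
case: t tX tY {h zt} twin => [[u|] s] //= uX + twin.
rewrite !inE (negPf uX) /= => /orP[]/eqP E'; subst u.
  by constructor 2; apply: twin; rewrite // eq_sym.
by constructor 3; apply: twin.
Qed.

(** In [star], following the row at y contradicts the edge zy, and being a twin of y contradicts
    [E_block]; only the twin of x remains. *)
Let common_nb x y z : x \notin X -> y \notin X -> z \notin X ->
  E x y -> E z y -> tau x = tau z.
Proof.
move=> xX yX zX xy zy; case: (eqVneq z x) => [-> // | zx].
have zny := E_neq zX zy.
case: (star xX yX zX xy zx zny) => [[_ h]|[-> //]|[h _]].
  by move: h; rewrite E_row ?zy ?E_block //; case: row.
by have := E_block zX yX zy; rewrite h eqxx.
Qed.

(** Were z a twin of x in [star], both would have the same adjacency to y, although x deviates there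
    from the common row and z does not. *)
Let other_nb x y z : x \notin X -> y \notin X -> z \notin X ->
  E x y -> ~~ E z y -> (tau z).1 = (tau x).1 -> z != x ->
  G z x = row (tau z) x.
Proof.
move=> xX yX zX xy zy tzx zx.
have zby : (tau z).1 != (tau y).1 by rewrite tzx E_block.
case: (star xX yX zX xy zx (block_neq zby)) => [[] // | [tt h] | [tt _]].
  move: h; rewrite (E_row zX yX zby) (E_row xX yX (E_block xX yX xy)).
  by rewrite xy (negPf zy) tt; case: row.
by move: zby; rewrite tt eqxx.
Qed.

(** The isolated vertices of one block follow their attachments on all other vertices, by [other_nb]
    inside the block and [E_row] outside it, so they would decompose G. *)
Let E_nb x : x \notin X -> exists2 y, y \notin X & E x y.
Proof.
move=> xX; case: (boolP [exists y, (y \notin X) && E x y]) => [|/existsPn niso].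
  by case/existsP=> y /andP[]; exists y.
pose isolated z := [forall y, (y \notin X) ==> ~~ E z y].
pose S := [set z | [&& z \notin X, (tau z).1 == (tau x).1 & isolated z]].
suff /negP[] : ~~ indec setT by [].
apply: (@follow_class_decomposable _ _ X _ (tau x).1 S) => //.
  apply/set0Pn; exists x; rewrite inE xX eqxx; apply/forallP=> y.
  by apply/implyP=> yX; have := niso y; rewrite yX.
move=> z; rewrite inE => /and3P[zX /eqP zB /forallP zi].
exists (tau z).2; rewrite -zB -surjective_pairing; first exact: tauP.
move=> w _ wX; rewrite inE wX /=.
have zw : ~~ E z w by have := zi w; rewrite wX.
rewrite -zB; case: (eqVneq (tau w).1 (tau z).1) => [tt | tt] /=.
  case/forallPn=> y; rewrite negb_imply negbK => /andP[yX wy].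
  have zy : ~~ E z y by have := zi y; rewrite yX.
  have zNw : z != w by apply: contraTneq wy => <-.
  exact: other_nb wX yX zX wy zy (esym tt) zNw.
by move=> _; rewrite E_row ?(negPf zw) // eq_sym.
Qed.

Let row_tau t x y : x \notin X -> y \notin X -> block_in X t.1 ->
  tau x = tau y -> row t x = row t y.
Proof.
move=> xX yX tX xy; rewrite !(row_notin _ _ tX) //; case: t tX => [[u|] s] //= uX.
have [_ _ hx] := typedP _ _ _ _ (tauP xX); have [_ _ hy] := typedP _ _ _ _ (tauP yX).
by rewrite ![G u _]adj_sym hx // hy // xy.
Qed.

(** Vertices with equal neighbourhoods in G_X have equal attachments by [common_nb], and the class
    of all of them would be an interval of G. *)
Let E_separates x y : x \notin X -> y \notin X -> x != y ->
  exists2 z, z \notin X & E x z != E y z.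
Proof.
move=> xX yX xy; pose same u v := [forall z, (z \notin X) ==> (E u z == E v z)].
case: (boolP (same x y)) => [sxy | ]; last first.
  case/forallPn=> z; rewrite negb_imply => /andP[zX h]; by exists z.
pose S := [set z | (z \notin X) && same x z].
have xS : x \in S by rewrite inE xX; apply/forallP=> z; rewrite eqxx implybT.
have yS : y \in S by rewrite inE yX.
have SX z : z \in S -> z \notin X by rewrite inE => /andP[].
have nbS z w : z \in S -> w \notin X -> E z w = E x w.
  by rewrite inE => /andP[_ /forallP/(_ w)] + wX; rewrite wX => /eqP->.
have [a aX xa] := E_nb xX.
have tS z : z \in S -> tau z = tau x.
  move=> zS; have za : E z a by rewrite nbS.
  exact: common_nb (SX z zS) aX xX za xa.
have rS t p q : p \in S -> q \in S -> block_in X t.1 -> row t p = row t q.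
  by move=> pS qS tX; apply: row_tau; rewrite ?SX // !tS.
have tB v : v \notin X -> block_in X (tau v).1 by case/tauP/typedP.
suff /negP[] : ~~ indec setT by [].
apply/indecNP; exists S; last first.
  split; first exact: card_gt1_in xS yS xy.
  have /card_gt0P[c cX] : 0 < #|X| by apply: leq_trans X3.
  by apply/negP=> /eqP/setP/(_ c); rewrite !inE cX.
split=> [|v p q _ vS pS qS]; first exact: subsetT.
have [pX qX] := (SX p pS, SX q qS).
case: (boolP (v \in X)) => vX.
  rewrite ![G v _]adj_sym.
  have [_ _ hp] := typedP _ _ _ _ (tauP pX); have [_ _ hq] := typedP _ _ _ _ (tauP qX).
  by rewrite hp // hq // !tS.
(* In a different block, [E_row] decides. In the same block, some w is a neighbour of v or of the
   class but not of both, and [other_nb] makes the side not adjacent to w follow its row. *)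
case: (eqVneq (tau v).1 (tau x).1) => tvx; last first.
  rewrite (E_row vX pX) ?(tS p) // (E_row vX qX) ?(tS q) // (rS _ _ _ pS qS) ?tB //.
  by rewrite [E v p]Esym [E v q]Esym !nbS.
have := vS; rewrite inE vX /= => /forallPn[w].
rewrite negb_imply => /andP[wX]; case: (boolP (E x w)) => xw vw; last first.
  have {}vw : E v w by move: vw; case: (E v w).
  have k z : z \in S -> G v z = row (tau x) v.
    move=> zS; rewrite adj_sym -(tS z zS).
    apply: (other_nb vX wX (SX z zS) vw _ _ (neq_mem zS vS)).
      by rewrite nbS.
    by rewrite tS.
  by rewrite !k.
have {}vw : ~~ E v w by move: vw; case: (E v w).
have k z : z \in S -> G v z = row (tau v) z.
  move=> zS; have zv := neq_mem zS vS; rewrite eq_sym in zv.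
  have zw : E z w by rewrite nbS.
  apply: (other_nb (SX z zS) wX vX zw vw _ zv).
  by rewrite tvx tS.
by rewrite !k // (rS _ _ _ pS qS) ?tB.
Qed.

(** Some z is a neighbour of just one of x and y by [E_separates], and [other_nb] then applies to
    the other. *)
Let same_tau x y : x \notin X -> y \notin X -> tau x = tau y -> x != y ->
  G x y = row (tau x) y.
Proof.
move=> xX yX txy xy; have [z zX] := E_separates xX yX xy.
case: (boolP (E x z)) => xz yz; last first.
  have {}yz : E y z by move: yz; case: (E y z).
  by apply: (other_nb _ zX _ yz); rewrite ?txy.
have {}yz : ~~ E y z by move: yz; case: (E y z).
rewrite adj_sym (other_nb xX zX yX xz yz) ?txy // 1?eq_sym //.
by apply: row_tau => //; case/tauP/typedP: yX.
Qed.

Lemma exists_path_extension : exists t0 t1 f, path_extension X t0 t1 f.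
Proof.
pose g (i : 'I_5) : V := enum_val (cast_ord (esym CX5) i).
have gX i : g i \notin X by have := enum_valP (cast_ord (esym CX5) i); rewrite inE.
have g_inj : injective g by move=> i j /enum_val_inj/cast_ord_inj.
have g_onto x : x \notin X -> exists i, g i = x.
  move=> xX; have xC : x \in ~: X by rewrite inE.
  by exists (cast_ord CX5 (enum_rank_in xC x)); rewrite /g cast_ordK enum_rankK_in.
have [||||| p p_inj hp] := @five_path (fun i j => E (g i) (g j)).
- by move=> i j; apply: Esym.
- by move=> i; apply: Eirr.
- by move=> i; have [y /g_onto[j <-]] := E_nb (gX i); exists j.
- move=> i j ij; have [|y /g_onto[k <-] h] := E_separates (gX i) (gX j).
    by rewrite (inj_eq g_inj).
  by exists k.
(* Along a closed walk of length 5, [common_nb] gives the first, third and fifth vertices one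
   attachment, but the fifth and the first are adjacent. *)
- move=> i j k l m ij jk kl lm; apply/negP=> mi.
  have ik : tau (g i) = tau (g k) by apply: common_nb ij _; rewrite // Esym.
  have km : tau (g k) = tau (g m) by apply: common_nb kl _; rewrite // Esym.
  by have := E_block (gX m) (gX i) mi; rewrite ik km eqxx.
pose f i := g (p i); pose o (k : nat) : 'I_5 := inord k.
have fX i : f i \notin X by apply: gX.
have Ef i j : E (f i) (f j) = path_rel i j by rewrite hp.
have f_inj : injective f by move=> i j /g_inj/p_inj.
have par : forall i : 'I_5, tau (f i) = if odd i then tau (f (o 1)) else tau (f (o 0)).
  have step i j k : path_rel (i : 'I_5) (j : 'I_5) -> path_rel (k : 'I_5) j ->
      tau (f k) = tau (f i).
    by move=> ij kj; apply: (@common_nb _ (f j)); rewrite ?Ef.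
  have t3 : tau (f (o 3)) = tau (f (o 1)).
    by apply: (step _ (o 2)); rewrite !inordK.
  have t2 : tau (f (o 2)) = tau (f (o 0)).
    by apply: (step _ (o 1)); rewrite !inordK.
  have t4 : tau (f (o 4)) = tau (f (o 2)).
    by apply: (step _ (o 3)); rewrite !inordK.
  move=> i; rewrite -[i]inord_val -/(o i); case: i => i /= i5.
  rewrite inordK //; case: i i5 => [|[|[|[|[|//]]]]] //= _; by rewrite ?t4.
have t01 : (tau (f (o 0))).1 != (tau (f (o 1))).1.
  by apply: (E_block (fX _) (fX _)); rewrite Ef !inordK.
exists (tau (f (o 0))), (tau (f (o 1))), f; split=> //.
- apply/eqP; rewrite eqEcard card_imset // card_ord CX5 leqnn andbT.
  by apply/subsetP=> _ /imsetP[i _ ->]; rewrite inE.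
- by move=> i; rewrite -par; apply: tauP.
move=> i j ij; rewrite -par.
case: (eqVneq (tau (f i)) (tau (f j))) => tij; last first.
  rewrite (E_row (fX i) (fX j)) ?Ef //; move: tij; rewrite (par i) (par j).
  by case: (odd i); case: (odd j); rewrite ?eqxx // => _; rewrite eq_sym.
have fij : f i != f j by rewrite (inj_eq f_inj).
rewrite (same_tau (fX i) (fX j) tij fij) -Ef.
case: (boolP (E (f i) (f j))) => // e.
by have := E_block (fX i) (fX j) e; rewrite tij eqxx.
Qed.

End Existence.
End PathExtension.

(** * Exchanging twins: which vertices can be blocks *)

Lemma indec_imset (W V : finType) (H : sgraph W) (G : sgraph V) (g : W -> V)
    (X : {set W}) : {in X &, injective g} ->
  {in X &, forall x y, x != y -> G (g x) (g y) = H x y} ->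
  indec H X -> indec G (g @: X).
Proof.
move=> g_inj gG iX; apply/indecP=> I [/subsetP IgX hI].
pose J := X :&: g @^-1: I.
have IJ : I = g @: J.
  apply/setP=> v; apply/idP/imsetP => [vI|[x]]; last by rewrite !inE => /andP[_ ?] ->.
  have /imsetP[x xX vx] := IgX v vI.
  by exists x; rewrite // !inE xX -vx.
have [|J1|JX] := elimT (indecP H X) iX J.
- split=> [|w x y wX]; first exact: subsetIl.
  rewrite !inE wX /= => gwI /andP[xX gxI] /andP[yX gyI].
  have k z : z \in X -> g z \in I -> H w z = G (g w) (g z).
    by move=> zX gzI; rewrite gG //; apply: contraNneq gwI => ->.
  by rewrite !k //; apply: hI => //; apply: imset_f.
- by left; rewrite IJ; apply: leq_trans (leq_imset_card _ _) J1.
by right; rewrite IJ JX.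
Qed.

Section Blocks.
Variables (V : finType) (G : sgraph V).
Implicit Types (X Y S I : {set V}) (t : option V * bool) (x y u v : V).

Local Notation indec := (indec G).
Local Notation typed := (typed G).
Local Notation row := (row G).

(** Replacing u by v is an isomorphism: u itself leaves the set, so the sign [s] is irrelevant. *)
Lemma indec_swap X u s v : indec X -> typed X (Some u, s) v ->
  indec (v |: X :\ u).
Proof.
move=> iX /typedP[vX /= uX h].
have -> : v |: X :\ u = (fun x => if x == u then v else x) @: X.
  apply/setP=> x; rewrite !inE; apply/orP/imsetP => [[/eqP->|/andP[xu xX]]|].
  - by exists u; rewrite ?eqxx.
  - by exists x; rewrite ?(negPf xu).
  case=> y yX ->; case: (eqVneq y u) => [_|yu]; first by left.
  by right; rewrite yu.
have vN x : x \in X -> v == x = false.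
  by move=> xX; apply/negbTE; rewrite eq_sym (neq_mem xX vX).
have hu x : x \in X -> x != u -> G v x = G u x.
  by move=> xX xu; rewrite h // /row /= (negPf xu).
apply: indec_imset iX => x y xX yX.
  case: eqP => [->|_]; case: eqP => [->|_] // /eqP; first by rewrite vN.
  by rewrite eq_sym vN.
case: (eqVneq x u) => [->|xu]; case: (eqVneq y u) => [->|yu] //.
- by move=> _; apply: hu.
by move=> _; rewrite adj_sym hu // adj_sym.
Qed.

Lemma path_extension_typed X t0 t1 f x : path_extension G X t0 t1 f ->
  x \notin X -> typed X t0 x \/ typed X t1 x.
Proof.
case=> _ fX _ ft _ xX; have : x \in f @: 'I_5 by rewrite fX inE.
by case/imsetP=> i _ ->; have := ft i; case: odd; [right | left].
Qed.

(* After exchanging the twins u and v, the vertices v', y and z have three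
   different attachments to the new set. *)
Lemma block_not_exchangeable (C X : {set V}) u s t v v' y z :
  indec setT -> indec X -> 2 < #|X| -> #|~: X| = 5 -> C \subset X ->
  (forall x y, x \notin C -> y \notin C -> x != y -> ~~ indec (~: [set x; y])) ->
  typed X (Some u, s) v -> typed X (Some u, s) v' -> typed X t y ->
  typed X t z -> t.1 != Some u -> v != v' -> v != y -> v != z ->
  G y v != G z v -> u \in C.
Proof.
move=> iT iX X3 CX5 CX nI vt v't yt zt tu vv' vy vz yzv.
case: (boolP (u \in C)) => // uC; pose X' := v |: X :\ u.
have [vX /= uX _] := typedP _ _ _ _ vt.
have cX' : #|X'| = #|X|.
  by rewrite cardsU1 [in RHS](cardsD1 u X) uX !inE negb_and vX orbT.
have CX'5 : #|~: X'| = 5 by apply/eqP; rewrite -CX5 -(eqn_add2l #|X'|) cardsC cX' cardsC.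
have [|x x' xX' x'X'|t0 [t1 [f hf]]] :=
  @exists_path_extension _ G X' iT (indec_swap iX vt) _ CX'5.
- by rewrite cX'.
(* As u is not in [C], the exchanged set still contains [C], and no removable pair lies outside
   it. *)
- have out w : w \notin X' -> w \notin C.
    rewrite !inE negb_or negb_and negbK => /andP[_ /orP[/eqP->|wX]] //.
    by apply: contra wX; apply: (subsetP CX).
  by apply: nI; apply: out.
have outX' w : w \notin X -> v != w -> w \notin X'.
  by move=> wX vw; rewrite !inE negb_or negb_and wX orbT andbT eq_sym.
have [v'X _ hv'] := typedP _ _ _ _ v't.
have [yX tX hy] := typedP _ _ _ _ yt; have [zX _ hz] := typedP _ _ _ _ zt.
(* On [X :\ u] the vertex v' looks like u, so a w agreeing with it there would be attached to u. *)
have twin w : typed X t w -> ~ {in X', G v' =1 G w}.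
  move=> wt h; have [wX _ hw] := typedP _ _ _ _ wt.
  suff /(typed_inj iX X3 wt) E : typed X (Some u, G w u) w by rewrite E eqxx in tu.
  apply/typedP; split=> // x xX; rewrite /row /=.
  case: (eqVneq x u) => [-> // | xu].
  rewrite -h ?inE ?xu ?xX ?orbT // hv' // /row /=.
  by rewrite (negPf xu).
have same t' w w' : typed X' t' w -> typed X' t' w' -> {in X', G w =1 G w'}.
  by move=> /typedP[_ _ h] /typedP[_ _ h'] x xX'; rewrite h // h'.
have NT w : typed X t w -> forall t', typed X' t' v' -> ~ typed X' t' w.
  by move=> wt t' v't' wt'; apply: twin wt (same t' _ _ v't' wt').
have yz t' : typed X' t' y -> ~ typed X' t' z.
  by move=> yt' zt'; case/eqP: yzv; apply: same yt' zt' _ _; rewrite !inE eqxx.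
have [v't'|v't'] := path_extension_typed hf (outX' v' v'X vv');
have [yt'|yt'] := path_extension_typed hf (outX' y yX vy);
have [zt'|zt'] := path_extension_typed hf (outX' z zX vz);
  by [case: (NT y yt _ v't' yt') | case: (NT z zt _ v't' zt') | case: (yz _ yt' zt')].
Qed.

Lemma path_extension_block (C X : {set V}) t0 t1 f u s x :
  indec setT -> indec X -> 2 < #|X| -> #|~: X| = 5 -> C \subset X ->
  (forall x y, x \notin C -> y \notin C -> x != y -> ~~ indec (~: [set x; y])) ->
  path_extension G X t0 t1 f -> typed X (Some u, s) x -> u \in C.
Proof.
move=> iT iX X3 CX5 CX nI hf xu; have [f_inj _ t01 ft fG] := hf.
have xX : x \notin X by case/typedP: xu.
pose o k : 'I_5 := inord k.
have oE k : k < 5 -> o k = k :> nat by move=> k5; rewrite inordK.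
have fN j k : j < 5 -> k < 5 -> j != k -> f (o j) != f (o k).
  by move=> j5 k5 jk; rewrite (inj_eq f_inj) -val_eqE /= !oE.
have t k : k < 5 -> typed X (if odd k then t1 else t0) (f (o k)).
  by move=> k5; have := ft (o k); rewrite oE.
have e j k : j < 5 -> k < 5 -> j != k -> G (f (o j)) (f (o k)) =
    path_rel j k (+) row (if odd j then t1 else t0) (f (o k)).
  by move=> j5 k5 jk; rewrite fG ?oE // -val_eqE /= !oE.
have main t' v v' y z :=
  @block_not_exchangeable C X u s t' v v' y z iT iX X3 CX5 CX nI.
have [/(typed_inj iX X3 xu) E | /(typed_inj iX X3 xu) E] := path_extension_typed hf xX.
  (* The exchanged vertex must tell y and z apart: f 0 is joined in the path to f 1 but not to f 3,
     over the same row. Below, f 1 does this for f 0 and f 4. *)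
  apply: (main t1 (f (o 0)) (f (o 2)) (f (o 1)) (f (o 3))); rewrite ?E ?fN //.
  - exact: (t 0).
  - exact: (t 2).
  - exact: (t 1).
  - exact: (t 3).
  - by rewrite eq_sym; move: t01; rewrite -E.
  by rewrite !e //; case: row.
apply: (main t0 (f (o 1)) (f (o 3)) (f (o 0)) (f (o 4))); rewrite ?E ?fN //.
- exact: (t 1).
- exact: (t 3).
- exact: (t 0).
- exact: (t 4).
- by move: t01; rewrite -E.
by rewrite !e //; case: row.
Qed.

End Blocks.

(** * Certificates against the wrong pairs of attachments *)

Definition interval_free (g : nat -> nat -> bool) k : bool :=
  let r := iota 0 k in
  all (fun b => [|| count id b <= 1, all id b |
    has (fun i => ~~ nth false b i && has (fun j => nth false b j &&
      has (fun l => nth false b l && (g i j != g i l)) r) r) r]) (bitseqs k).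

Lemma indec_seq (V : finType) (G : sgraph V) (x0 : V) (s : seq V)
    (g : nat -> nat -> bool) : uniq s ->
  (forall i j, i < size s -> j < size s -> i != j ->
     G (nth x0 s i) (nth x0 s j) = g i j) ->
  interval_free g (size s) -> indec G [set x in s].
Proof.
move=> us hg /allP hf; apply/indecP=> I [/subsetP Is hI].
have hb : [seq x \in I | x <- s] \in bitseqs (size s).
  by rewrite -(size_map (fun x => x \in I) s); apply: mem_bitseqs.
have nthI i : i < size s -> nth false [seq x \in I | x <- s] i = (nth x0 s i \in I).
  exact: nth_map.
have IE : I =i [seq x <- s | x \in I].
  move=> x; rewrite mem_filter; case: (boolP (x \in I)) => //= xI.
  by have := Is x xI; rewrite inE.
case/or3P: (hf _ hb) => [c1 | aI |].
- left; rewrite (eq_card IE) (card_uniqP (filter_uniq _ us)) size_filter.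
  by rewrite count_map in c1; apply: leq_trans c1; apply: eq_leq; apply: eq_count.
- right; apply/setP=> x; rewrite inE; apply/idP/idP => [/Is|xs]; rewrite ?inE //.
  by move: aI; rewrite all_map => /allP/(_ x xs).
case/hasP=> i; rewrite mem_iota => /andP[_ i_s] /andP[bi /hasP[j]].
rewrite mem_iota => /andP[_ j_s] /andP[bj /hasP[l]].
rewrite mem_iota => /andP[_ l_s] /andP[bl].
rewrite add0n in i_s j_s l_s; rewrite !nthI // in bi bj bl.
have ne k : nth x0 s k \in I -> i != k by move=> kI; apply: contraNneq bi => ->.
rewrite -!hg ?ne // (hI _ (nth x0 s j) (nth x0 s l)) ?eqxx //.
by rewrite inE mem_nth.
Qed.

Definition Q_label_adj m a b : bool :=
  [|| [&& a <= m - 2, b <= m - 2 & path_rel a b], Q_star m a b | Q_star m b a].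

(* The code (true, a) stands for the label a and (false, b) for the label m - b.
   Adjacency of codes does not depend on m, as long as the two kinds of labels
   stay at distance at least 2. *)
Definition code_adj (c d : bool * nat) : bool :=
  match c, d with
  | (true, a), (true, b) => path_rel a b
  | (true, _), (false, b) => b == 1
  | (false, a), (true, _) => a == 1
  | (false, 0), (false, b) => b == 1
  | (false, 1), (false, b) => (b != 1) && (b != 2)
  | (false, a), (false, b) => if b <= 1 then (b == 1) && (a != 2) else path_rel a b
  end.

Definition code_bound l r (c : bool * nat) : bool :=
  if c.1 then 0 < c.2 <= l else c.2 <= r.

Definition code_row (t : option (bool * nat) * bool) (c : bool * nat) : bool :=
  if t.1 is Some u then if c == u then t.2 else code_adj u c else t.2.

(** Indices 0 and 1 are the ends y and z of an edge of G_X, index [k.+2] is the k-th code. [yz]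
    negates what [t] prescribes to y at z: the sign without a block, otherwise the adjacency of z to
    the block, read off from [t']. *)
Definition deviation_adj (t t' : option (bool * nat) * bool)
    (cs : seq (bool * nat)) (i j : nat) : bool :=
  let c k := nth (true, 0) cs k in
  let yz := ~~ (if t.1 is Some u then code_row t' u else t.2) in
  match i, j with
  | 0, 0 | 1, 1 => false
  | 0, 1 | 1, 0 => yz
  | 0, k.+2 | k.+2, 0 => code_row t (c k)
  | 1, k.+2 | k.+2, 1 => code_row t' (c k)
  | k.+2, l.+2 => code_adj (c k) (c l)
  end.

Definition attachment_code : Type := option (bool * nat) * bool.

(* For each forbidden pair of attachments, an even and an odd number of labels
   that form an indecomposable subgraph together with the ends of an edge of
   G_X; the bounds on the labels hold for m >= 7 and m >= 8 respectively. *)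
Definition deviation_table : seq (attachment_code * attachment_code *
    ((nat * nat * seq (bool * nat)) * (nat * nat * seq (bool * nat)))) :=
  let L := pair true in let R := pair false in
  let none b : attachment_code := (None, b) in
  let first b : attachment_code := (Some (L 1), b) in
  let last b : attachment_code := (Some (R 0), b) in
  let s12 := [:: L 1; L 2; R 0] in
  let s14 := [:: L 1; L 2; L 3; L 4; R 0] in
  let s15 := [:: L 1; L 2; L 3; L 4; L 5; R 0] in
  let s1 := [:: L 1; R 0] in
  [:: (none false, first false, ((2, 1, R 1 :: s12), (5, 1, R 1 :: s15)));
      (none false, first true, ((4, 1, R 1 :: s14), (1, 1, R 1 :: s1)));
      (none false, last true,
        ((1, 4, [:: L 1; R 4; R 3; R 2; R 1; R 0]), (1, 1, R 1 :: s1)));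
      (none true, first false, ((5, 0, s15), (2, 0, s12)));
      (none true, first true, ((1, 0, s1), (4, 0, s14)));
      (none true, last true,
        ((1, 0, s1), (1, 3, [:: L 1; R 3; R 2; R 1; R 0])));
      (first false, last true, ((5, 0, s15), (2, 0, s12)));
      (first true, last true, ((1, 0, s1), (4, 0, s14)))].

(** With y and z the certificate has [size cs] + 2 of the m + 5 vertices, so the complement is even
    exactly when [size cs] and m have opposite parity. Blocks must occur among the codes for
    [code_row] to be exact. *)
Definition deviation_ok (n : nat) (t t' : attachment_code)
    (d : nat * nat * seq (bool * nat)) : bool :=
  let cs := d.2 in
  [&& d.1.1 + d.1.2 + 2 <= n, size cs <= n, odd (size cs) == ~~ odd n,
      all (code_bound d.1.1 d.1.2) cs, uniq cs,
      if t.1 is Some u then u \in cs else true,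
      if t'.1 is Some u then u \in cs else true,
      (true, 1) \in cs, (false, 0) \in cs &
      interval_free (deviation_adj t t' cs) (size cs).+2].

Lemma deviation_tableP : all (fun e =>
  deviation_ok 7 e.1.1 e.1.2 e.2.1 && deviation_ok 8 e.1.1 e.1.2 e.2.2)
  deviation_table.
Proof. by vm_compute. Qed.

Definition forbidden_pair (t t' : attachment_code) : bool :=
  (t, t') \in [seq e.1 | e <- deviation_table].

Definition end_attachments : seq attachment_code :=
  [seq (B, b) | B <- [:: None; Some (true, 1); Some (false, 0)],
                b <- [:: false; true]].

(** There are twelve unordered pairs with different blocks. The table excludes eight; the other four
    all contain the attachment to label m with sign [false]. *)
Lemma allowed_pair :
  all (fun t => all (fun t' => [|| t.1 == t'.1, forbidden_pair t t',
    forbidden_pair t' t, (t == (Some (false, 0), false)) && (t'.1 != t.1) |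
    (t' == (Some (false, 0), false)) && (t'.1 != t.1)])
    end_attachments) end_attachments.
Proof. by vm_compute. Qed.

(** * The graph Q_m on labelled vertices *)

Section LabelledQ.
Variables (V : finType) (G : sgraph V) (X : {set V}) (m : nat) (lab : nat -> V).
Hypothesis m4 : 3 < m.
Hypothesis labX : forall x,
  reflect (exists2 a, 0 < a <= m & x = lab a) (x \in X).
Hypothesis lab_inj : forall a b, 0 < a <= m -> 0 < b <= m -> lab a = lab b -> a = b.
Hypothesis labG : forall a b, 0 < a <= m -> 0 < b <= m ->
  G (lab a) (lab b) = Q_label_adj m a b.

Local Notation indec := (indec G).
Local Notation typed := (typed G).
Local Notation row := (row G).

Lemma lab_in a : 0 < a <= m -> lab a \in X.
Proof. by move=> ha; apply/labX; exists a. Qed.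

Lemma Q_label_path a b : a <= m - 2 -> b <= m - 2 ->
  Q_label_adj m a b = path_rel a b.
Proof. by rewrite /Q_label_adj /Q_star /path_rel; lia. Qed.

Lemma Q_label_hub a : a <= m -> Q_label_adj m (m - 1) a = (a != m - 1) && (a != m - 2).
Proof. by rewrite /Q_label_adj /Q_star /path_rel; lia. Qed.

Lemma Q_label_leaf a : a <= m -> Q_label_adj m m a = (a == m - 1).
Proof. by rewrite /Q_label_adj /Q_star /path_rel; lia. Qed.

Lemma Q_label_adjC a b : Q_label_adj m a b = Q_label_adj m b a.
Proof. by rewrite /Q_label_adj /Q_star /path_rel; lia. Qed.

(** The hub m - 1 is joined to all but m - 2, the leaf m only to the hub. A nontrivial interval
    without the hub misses m - 2 too, and the end of its last stretch of path refutes it. With the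
    hub, the leaf would separate the hub from another element, each c < m - 2 the hub from the leaf,
    and m - 2 would separate m - 3 from the leaf: nothing is missing. *)
Lemma Q_label_indec : indec X.
Proof.
apply/indecP=> I [IX hI].
have labI x : x \in I -> exists2 a, 0 < a <= m & x = lab a.
  by move/(subsetP IX)/labX.
pose inI a := lab a \in I.
have hI' v a b : 0 < v <= m -> 0 < a <= m -> 0 < b <= m -> inI a -> inI b ->
    ~~ inI v -> Q_label_adj m v a = Q_label_adj m v b.
  by move=> hv ha hb aI bI vI; rewrite -!labG //; apply: hI => //; apply: lab_in.
have [|I1] := leqP #|I| 1; first by left.
right; have [x [y [xI yI xy]]] := card_gt1_ex I1.
have [a ha xa] := labI x xI; have [b hb yb] := labI y yI.
have ab : a != b by apply: contraNneq xy => ab; rewrite xa yb ab.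
have aI : inI a by rewrite /inI -xa.
have bI : inI b by rewrite /inI -yb.
(* The path vertex following the last path vertex of I is joined to that vertex
   but to no other element of I. *)
have next c : 0 < c <= m - 2 -> inI c -> ~~ inI (m - 1) -> ~~ inI (m - 2) ->
    exists2 d, 0 < d < m - 2 & inI d /\ forall e, 0 < e <= m -> inI e -> e = d.
  move=> hc cI nh np.
  pose P d := (0 < d <= m - 2) && inI d.
  have exP : exists d, P d by exists c; rewrite /P hc.
  have ubP d : P d -> d <= m - 2 by case/andP=> /andP[].
  case: (ex_maxnP exP ubP) => d /andP[hd dI] dmax.
  have dlt : d != m - 2 by apply: contraNneq np => <-.
  have hd1 : 0 < d < m - 2 by clear -hd dlt; lia.
  exists d => //; split=> // e he eI.
  have nd1 : ~~ inI d.+1.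
    apply/negP=> d1I; have : d.+1 <= d; last by rewrite ltnn.
    by apply: dmax; rewrite /P d1I andbT; clear -hd1; lia.
  have em : e != m - 1 by apply: contraNneq nh => <-.
  have := hI' d.+1 d e _ _ he dI eI nd1.
  rewrite Q_label_path; [|clear -hd1; lia|clear -hd1; lia].
  have [em2|em2] := leqP e (m - 2).
    rewrite Q_label_path //; last by clear -hd1; lia.
    have : e <= d by apply: dmax; rewrite /P eI andbT; clear -he em2; lia.
    by clear -hd1 he; rewrite /path_rel; lia.
  have -> : e = m by clear -he em em2; lia.
  rewrite Q_label_adjC Q_label_leaf; last by clear -hd1; lia.
  by clear -hd1 m4; rewrite /path_rel; lia.
have hub c : 0 < c <= m -> inI c -> ~~ inI (m - 1) -> ~~ inI (m - 2).
  move=> hc cI nh; apply/negP=> pI.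
  have k e : 0 < e <= m -> inI e -> e = m - 2.
    move=> he eI; have := hI' (m - 1) (m - 2) e _ _ he pI eI nh.
    have : e != m - 1 by apply: contraNneq nh => <-.
    by clear -he m4; rewrite !Q_label_hub; lia.
  by move: ab; rewrite (k a ha aI) (k b hb bI) eqxx.
have [hI1 | nh] := boolP (inI (m - 1)); last first.
  have np := hub a ha aI nh.
  have [c hc cI] : exists2 c, 0 < c <= m - 2 & inI c.
    have am : a != m - 1 by apply: contraNneq nh => <-.
    have bm : b != m - 1 by apply: contraNneq nh => <-.
    by case: (leqP a (m - 2)) => h; [exists a | exists b] => //; clear -ha hb ab am bm h; lia.
  have [d hd [dI du]] := next c hc cI nh np.
  by move: ab; rewrite (du a ha aI) (du b hb bI) eqxx.
have mI : inI m.
  apply/negPn/negP=> nm.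
  have k e : 0 < e <= m -> inI e -> e = m - 1.
    move=> he eI; have := hI' m (m - 1) e _ _ he hI1 eI nm.
    by clear -he m4; rewrite !Q_label_leaf; lia.
  by move: ab; rewrite (k a ha aI) (k b hb bI) eqxx.
have pathI c : 0 < c < m - 2 -> inI c.
  move=> hc; apply/negPn/negP=> nc.
  have := hI' c (m - 1) m _ _ _ hI1 mI nc.
  by clear -hc m4; rewrite ![Q_label_adj m c _]Q_label_adjC Q_label_hub ?Q_label_leaf; lia.
have lastI : inI (m - 2).
  apply/negPn/negP=> nc.
  have := hI' (m - 2) (m - 3) m _ _ _ (pathI _ _) mI nc.
  rewrite Q_label_path 1?[Q_label_adj m _ m]Q_label_adjC ?Q_label_leaf /path_rel;
    clear -m4; lia.
apply/eqP; rewrite eqEsubset IX /=; apply/subsetP=> _ /labX[c hc ->].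
rewrite -/(inI c); have [->//|cm] := eqVneq c m.
have [->//|cm1] := eqVneq c (m - 1); have [->//|cm2] := eqVneq c (m - 2).
by apply: pathI; clear -hc cm cm1 cm2; lia.
Qed.


Definition code_label (c : bool * nat) : nat := if c.1 then c.2 else m - c.2.

Lemma code_adjP l r c d : l + r + 2 <= m -> code_bound l r c ->
  code_bound l r d ->
  Q_label_adj m (code_label c) (code_label d) = code_adj c d.
Proof.
rewrite /code_label /code_bound => lrm.
case: c => [[] a]; case: d => [[] b] /= ha hb.
- by rewrite Q_label_path //; clear -lrm ha hb; lia.
- by rewrite /Q_label_adj /Q_star /path_rel; clear -lrm ha hb; lia.
- by rewrite /Q_label_adj /Q_star /path_rel; clear -lrm ha hb; case: a ha => [|[|a]] ha; lia.
case: a ha => [|[|a]] ha.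
- by rewrite subn0 Q_label_leaf; clear -lrm ha hb m4; lia.
- by rewrite Q_label_hub; clear -lrm ha hb m4; lia.
case: ifP => hb1; last by rewrite Q_label_path /path_rel; clear -lrm ha hb hb1 m4; lia.
rewrite Q_label_adjC; case: b hb hb1 => [|[|b]] //= hb _.
  by rewrite subn0 Q_label_leaf; clear -lrm ha m4; lia.
by rewrite Q_label_hub; clear -lrm ha m4; lia.
Qed.

Lemma code_labelP l r c : l + r + 2 <= m -> code_bound l r c ->
  0 < code_label c <= m.
Proof. by clear; case: c => [[] a]; rewrite /code_label /code_bound /=; lia. Qed.

Lemma code_label_inj l r c d : l + r + 2 <= m -> code_bound l r c ->
  code_bound l r d -> code_label c = code_label d -> c = d.
Proof.
clear; rewrite /code_label /code_bound => lrm.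
by case: c => [[] a]; case: d => [[] b] /= ha hb E; try congr (_, _); lia.
Qed.

Definition code_vertex c : V := lab (code_label c).

Definition code_attachment (t : option (bool * nat) * bool) : option V * bool :=
  (omap code_vertex t.1, t.2).

(** Realizes a certificate in G: y and z deviate from their attachments only on each other, so
    [deviation_adj] computes all adjacencies. *)
Lemma deviation_indec l r t t' cs y z : l + r + 2 <= m ->
  typed X (code_attachment t) y -> typed X (code_attachment t') z -> y != z ->
  G y z = ~~ row (code_attachment t) z ->
  all (code_bound l r) cs -> uniq cs ->
  (if t.1 is Some u then u \in cs else true) ->
  (if t'.1 is Some u then u \in cs else true) ->
  interval_free (deviation_adj t t' cs) (size cs).+2 ->
  let s := [:: y, z & [seq code_vertex c | c <- cs]] in
  uniq s /\ indec [set x in s].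
Proof.
move=> lrm yt zt yz Gyz /allP cs_b cs_u tcs t'cs free s.
have [yX tX hy] := typedP _ _ _ _ yt; have [zX t'X hz] := typedP _ _ _ _ zt.
have cX c : c \in cs -> code_vertex c \in X.
  by move=> cc; apply: lab_in; apply: code_labelP lrm (cs_b c cc).
have c_inj : {in cs &, injective code_vertex}.
  move=> c d cc dc E; apply: (code_label_inj lrm (cs_b c cc) (cs_b d dc)).
  by apply: lab_inj E; apply: code_labelP lrm _; apply: cs_b.
have cN v : v \notin X -> v \notin [seq code_vertex c | c <- cs].
  by move=> vX; apply/mapP=> -[c cc vc]; move: vX; rewrite vc cX.
have us : uniq s.
  by rewrite /= inE negb_or yz !cN // map_inj_in_uniq.
split=> //; apply: (@indec_seq _ G y s (deviation_adj t t' cs) us); last first.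
  by rewrite /= size_map.
have rowE (q : option (bool * nat) * bool) c :
    (if q.1 is Some u then u \in cs else true) -> c \in cs ->
    row (code_attachment q) (code_vertex c) = code_row q c.
  case: q => [[u|] b] //= uc cc; rewrite /row /code_row /=.
  have -> : (code_vertex c == code_vertex u) = (c == u).
    by apply/eqP/eqP=> [|->] //; apply: c_inj.
  case: eqP => // _; rewrite labG ?(code_labelP lrm) ?(cs_b) //.
  by apply: code_adjP lrm _ _; apply: cs_b.
have Gyz' : G y z = ~~ (if t.1 is Some u then code_row t' u else t.2).
  rewrite Gyz (row_notin _ zX tX).
  case: (t) tcs => [[u|] b] //= uc; rewrite -rowE // adj_sym hz //.
  exact: cX.
rewrite /= size_map; set c0 := nth (true, 0) cs.
have nthc k : k < size cs -> nth y [seq code_vertex c | c <- cs] k = code_vertex (c0 k).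
  exact: nth_map.
have c0c k : k < size cs -> c0 k \in cs by apply: mem_nth.
move=> [|[|i]] [|[|j]] //=; rewrite ?ltnS => ik jk ij.
- by rewrite nthc // hy ?rowE ?cX ?c0c.
- by rewrite adj_sym.
- by rewrite nthc // hz ?rowE ?cX ?c0c.
- by rewrite nthc // adj_sym hy ?rowE ?cX ?c0c.
- by rewrite nthc // adj_sym hz ?rowE ?cX ?c0c.
rewrite !nthc // labG ?(code_labelP lrm) ?(cs_b) ?c0c //.
by apply: (code_adjP lrm); apply: cs_b; apply: c0c.
Qed.

Hypotheses (iT : indec setT) (VX5 : #|~: X| = 5).
Hypothesis nI : forall x y, x \notin [set lab 1; lab m] ->
  y \notin [set lab 1; lab m] -> x != y -> ~~ indec (~: [set x; y]).

Lemma card_labelled : #|X| = m.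
Proof.
have -> : X = [set lab i.+1 | i : 'I_m].
  apply/setP=> x; apply/labX/imsetP => [[a ha ->]|[i _ ->]]; last first.
    by exists i.+1; rewrite // ltn_ord.
  have am : a.-1 < m by clear -ha; lia.
  by exists (Ordinal am) => //=; rewrite prednK //; case/andP: ha.
rewrite card_imset ?card_ord // => i j /lab_inj E; apply: val_inj.
by case: (E (ltn_ord i) (ltn_ord j)).
Qed.

Lemma deviation_absurd l r t t' cs y z : l + r + 2 <= m ->
  typed X (code_attachment t) y -> typed X (code_attachment t') z -> y != z ->
  G y z = ~~ row (code_attachment t) z ->
  all (code_bound l r) cs -> uniq cs ->
  (if t.1 is Some u then u \in cs else true) ->
  (if t'.1 is Some u then u \in cs else true) ->
  interval_free (deviation_adj t t' cs) (size cs).+2 ->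
  (true, 1) \in cs -> (false, 0) \in cs -> size cs <= m ->
  odd (size cs) = ~~ odd m -> False.
Proof.
move=> lrm yt zt yz Gyz cs_b cs_u tcs t'cs free c1 cm csm podd.
have [us iS] := deviation_indec lrm yt zt yz Gyz cs_b cs_u tcs t'cs free.
set s := [:: y, z & _] in us iS.
have cS : #|[set x in s]| = (size cs).+2.
  by rewrite cardsE (card_uniqP us) /= size_map.
have cCS : (size cs).+2 + #|~: [set x in s]| = m + 5.
  by rewrite -cS cardsC -(cardsC X) VX5 card_labelled.
have [|||p [q [pS qS pq]]] := indec_del_pair iT iS.
- rewrite cS !ltnS; case: (cs) c1 => //.
- by clear -cCS csm; lia.
- by clear -cCS podd; lia.
apply/negP; have out v : v \notin [set x in s] -> v \notin [set lab 1; lab m].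
  apply: contra => /set2P[]->; rewrite !inE; apply/orP; right; apply/orP; right.
    by apply/mapP; exists (true, 1).
  by apply/mapP; exists (false, 0); rewrite // /code_vertex /code_label subn0.
by apply: nI => //; apply: out.
Qed.

Lemma forbidden_absurd t t' y z : 6 < m -> forbidden_pair t t' ->
  typed X (code_attachment t) y -> typed X (code_attachment t') z -> y != z ->
  G y z = ~~ row (code_attachment t) z -> False.
Proof.
move=> m7 /mapP[[[t1 t2] [d d']] te /= [-> ->]] yt zt yz Gyz.
have /andP[/= h h'] := allP deviation_tableP _ te.
(* 7 and 8 are the least values of m of each parity; a certificate checked there stays valid for
   every larger m of that parity. *)
have [n [e /and5P[lr sz po cb /and5P[us tc t'c c1 /andP[cm fr]]] [nm pm]]] :
    exists n, exists2 e, deviation_ok n t1 t2 e & n <= m /\ odd n = odd m.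
  case: (boolP (odd m)) => om; first by exists 7, d.
  exists 8, d' => //; split=> //.
  by rewrite ltn_neqAle m7 andbT; apply: contraNneq om => <-.
apply: (deviation_absurd (leq_trans lr nm) yt zt yz Gyz cb us tc t'c fr c1 cm).
  exact: leq_trans sz nm.
by rewrite -pm; apply/eqP.
Qed.

Lemma path_extension_attachments t0 t1 f : 6 < m ->
  path_extension G X t0 t1 f ->
  let leaf := (Some (lab m), false) in
  let other t := exists b, t = (None, b) \/ t = (Some (lab 1), b) in
  (t0 = leaf /\ other t1) \/ (t1 = leaf /\ other t0).
Proof.
move=> m7 hf leaf other; have [f_inj fX t01 ft fG] := hf.
have m0 : 0 < m by apply: leq_trans m7.
have X3 : 2 < #|X| by rewrite card_labelled; apply: leq_trans m7.
have CX : [set lab 1; lab m] \subset X.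
  by apply/subsetP=> x /set2P[]->; apply: lab_in; rewrite ?m0 ?leqnn.
have iX := Q_label_indec.
have code t x : typed X t x ->
    exists2 c, c \in end_attachments & t = code_attachment c.
  case: t => [[u|] b] ht; last first.
    by exists (None, b) => //; case: b {ht}.
  have := path_extension_block iT iX X3 VX5 CX nI hf ht.
  case/set2P=> ->; last first.
    exists (Some (false, 0), b); first by case: b {ht}.
    by rewrite /code_attachment /= /code_vertex /code_label subn0.
  by exists (Some (true, 1), b) => //; case: b {ht}.
have ft0 : typed X t0 (f (inord 0)) by have := ft (inord 0); rewrite inordK.
have ft1 : typed X t1 (f (inord 1)) by have := ft (inord 1); rewrite inordK.
have o01 : inord 0 != inord 1 :> 'I_5 by rewrite -val_eqE /= !inordK.
have f01 : f (inord 0) != f (inord 1) by rewrite (inj_eq f_inj).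
(* Both orientations of the edge are kept, since the table lists each pair of attachments in one
   order only. *)
have G01 : G (f (inord 0)) (f (inord 1)) = ~~ row t0 (f (inord 1)).
  by rewrite fG // !inordK.
have G10 : G (f (inord 1)) (f (inord 0)) = ~~ row t1 (f (inord 0)).
  by rewrite fG 1?eq_sym // !inordK.
have [c0 c0e E0] := code _ _ ft0; have [c1 c1e E1] := code _ _ ft1.
have c01 : c0.1 != c1.1 by apply: contraNneq t01 => c01; rewrite E0 E1 /= c01.
rewrite {}E0 in ft0 G01 *; rewrite {}E1 in ft1 G10 *.
have leafE : code_attachment (Some (false, 0), false) = leaf.
  by rewrite /code_attachment /= /code_vertex /code_label subn0.
have otherE c : c \in end_attachments -> c.1 != Some (false, 0) ->
    other (code_attachment c).
  rewrite !inE; do ! [case/orP|] => /eqP-> //= _;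
    [exists false | exists true | exists false | exists true]; by [left | right].
case/or4P: (allP (allP allowed_pair c0 c0e) c1 c1e).
- by rewrite (negPf c01).
- by move/(forbidden_absurd m7)/(_ ft0 ft1 f01 G01).
- by move/(forbidden_absurd m7)/(_ ft1 ft0); rewrite eq_sym => /(_ f01 G10).
case/orP=> /andP[/eqP E ne]; [left | right]; rewrite E leafE; split=> //.
  by apply: otherE => //; rewrite E in ne.
by apply: otherE => //; rewrite E eq_sym in ne.
Qed.

End LabelledQ.

(** * Properties of path extensions *)

Section PathExtensionTheory.
Variables (V : finType) (G : sgraph V) (X : {set V}).
Variables (t0 t1 : option V * bool) (f : 'I_5 -> V).
Hypotheses (iX : indec G X) (X3 : 2 < #|X|).
Hypothesis hf : path_extension G X t0 t1 f.

Local Notation indec := (indec G).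
Local Notation typed := (typed G).
Local Notation row := (row G).
Local Notation t i := (if odd (nat_of_ord i) then t1 else t0).

Let f_inj : injective f. Proof. by case: hf. Qed.

Let ft i : typed X (t i) (f i). Proof. by case: hf. Qed.

Let fG i j : i != j -> G (f i) (f j) = path_rel i j (+) row (t i) (f j).
Proof. by case: hf => _ _ _ _; apply. Qed.

Let fX i : f i \notin X. Proof. by case/typedP: (ft i). Qed.

Lemma path_extension_onto x : x \notin X -> exists i, x = f i.
Proof.
move=> xX; case: hf => _ fE _ _ _; have : x \in f @: 'I_5 by rewrite fE inE.
by case/imsetP=> i _ ->; exists i.
Qed.

Lemma path_rel_odd (i j : nat) : path_rel i j -> odd i != odd j.
Proof. by case/orP=> /eqP<- /=; case: odd. Qed.

Lemma path_extension_odd (i j : 'I_5) : (t i).1 = (t j).1 -> odd i = odd j.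
Proof.
by case: hf => _ _ + _ _; case: odd; case: odd => //= /eqP + E; case.
Qed.

Lemma path_extension_pair (i j : 'I_5) :
  indec (X :|: [set f i; f j]) = path_rel i j.
Proof.
have X2 : 1 < #|X| := ltnW X3.
have [pij | nij] := boolP (path_rel i j); last first.
  apply/negbTE; have [->|ij] := eqVneq i j.
    exact: same_block_decomposable X2 (ft j) (ft j) _.
  apply: (follow_decomposable X2 (ft i)) => //; first by rewrite (inj_eq f_inj).
  by rewrite fG // (negPf nij).
have oij := path_rel_odd pij; have ij : i != j by apply: contraNneq oij => ->.
apply/negPn/negP=> /(decomposable_follow iX X3 (ft i) (fX j)).
rewrite (inj_eq f_inj) ij => /(_ isT) h.
have {}h : G (f i) (f j) = row (t i) (f j).
  apply: h => t' /(typed_inj iX X3 (ft j)) <-; apply: contra oij => /eqP E.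
  exact/eqP/esym/path_extension_odd.
by have := fG ij; rewrite h pij; case: row.
Qed.

Lemma path_neighbour (i : 'I_5) : exists j : 'I_5, path_rel i j.
Proof.
case: i => [[|i] i5]; first by exists (Ordinal (isT : 1 < 5)).
by exists (Ordinal (ltnW i5)); rewrite /path_rel /= eqxx orbT.
Qed.

Lemma path_separates (i j : 'I_5) : i != j ->
  exists k : 'I_5, path_rel k i != path_rel k j.
Proof.
move=> ij; have h : all (fun i => all (fun j => (i == j) ||
    has (fun k => path_rel k i != path_rel k j) (iota 0 5)) (iota 0 5)) (iota 0 5).
  by vm_compute.
have r5 (k : 'I_5) : nat_of_ord k \in iota 0 5.
  by rewrite mem_iota ltn_ord.
have := allP (allP h i (r5 i)) j (r5 j); rewrite val_eqE (negPf ij) orFb => /hasP[k].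
by rewrite mem_iota => k5 hk; exists (Ordinal (k5 : k < 5)).
Qed.

Lemma path_extension_row q p r : block_in X q.1 -> p \notin X -> r \notin X ->
  {in X, G p =1 G r} -> row q p = row q r.
Proof.
move=> qX pX rX h; rewrite !(row_notin _ _ qX) //.
by case: q qX => [[u|] b] //= uX; rewrite ![G u _]adj_sym h.
Qed.

(** If the trace of an interval on [X] is [X] or {u}, an outer vertex on the wrong side is constant
    or attached to u, and its deviation at a path neighbour, whose attachment differs, is a
    contradiction. If the trace is empty, all elements share one attachment, and a path vertex
    adjacent to just one of two of them separates these. *)
Lemma path_extension_indec : indec setT.
Proof.
apply/indecP=> I hI; have [|I1] := leqP #|I| 1; [by left | right].
have [_ hI'] := hI.
have fne (i j : 'I_5) : path_rel i j -> i != j.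
  by move/path_rel_odd; apply: contraNneq => ->.
have twin i u : u \in X -> I :&: X = [set u] -> f i \in I ->
    t i = (Some u, G (f i) u).
  move=> uX EI fI; apply: typed_inj iX X3 (ft i) _; apply/typedP; split=> //.
  move=> z zX; rewrite /row /=; case: (eqVneq z u) => [-> // | zu].
  have uI : u \in I by move/setP/(_ u): EI; rewrite !inE eqxx => /andP[].
  rewrite ![G _ z]adj_sym; apply: hI'; rewrite ?inE //.
  by apply: contra zu => zI; have : z \in I :&: X by [apply/setIP]; rewrite EI inE.
have outer x : x \notin X -> exists i, x = f i := @path_extension_onto x.
case: (elimT (indecP G X) iX _ (interval_of_sub (subsetT X) hI)) => [I1'|IeX]; last first.
  have XI x : x \in X -> x \in I by rewrite -{1}IeX => /setIP[].
  have /card_gt0P[a aX] : 0 < #|X| by apply: leq_trans X3.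
  have none i : f i \notin I -> t i = (None, G (f i) a).
    move=> fI; apply: typed_inj iX X3 (ft i) _; apply/typedP; split=> // z zX.
    by apply: hI'; rewrite ?inE // XI.
  apply/setP=> x; rewrite [RHS]inE; apply/negPn/negP=> xI.
  have [i xi] : exists i, x = f i by apply: outer; apply: contra xI; apply: XI.
  rewrite {}xi in xI; have [j ij] := path_neighbour i.
  have [fjI|/none tj] := boolP (f j \in I); last first.
    by have /eqP := path_rel_odd ij; apply; apply: path_extension_odd; rewrite tj none.
  have := fG (fne i j ij); rewrite ij (none i xI) (hI' (f i) (f j) a (in_setT _) xI fjI (XI a aX)).
  by rewrite /row /=; case: (G _ _).
have [I0 | [u /setIP[uI uX]]] := set_0Vmem (I :&: X); last first.
  have EI : I :&: X = [set u].
    apply/setP=> z; rewrite [RHS]inE; apply/idP/eqP => [zI|->]; last exact/setIP.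
    by apply: card_le1_eq I1' _ _ => //; apply/setIP.
  have [p [q [pI qI pq]]] := card_gt1_ex I1.
  have [z zI zu] : exists2 z, z \in I & z != u.
    case: (eqVneq p u) => [E | ]; last by exists p.
    by exists q => //; rewrite -E eq_sym.
  have [i zi] : exists i, z = f i.
    apply: outer; apply: contra zu => zX.
    by have : z \in I :&: X by [apply/setIP]; rewrite EI inE.
  rewrite {}zi in zI zu; have [j ij] := path_neighbour i.
  have tiu := twin i u uX EI zI.
  have fjI : f j \notin I.
    apply/negP=> /(twin j u uX EI) tju.
    by have /eqP := path_rel_odd ij; apply; apply: path_extension_odd; rewrite tiu tju.
  have := fG (fne i j ij); rewrite ij tiu /row /= (negPf (_ : f j != u)).
    rewrite adj_sym (hI' (f j) (f i) u) ?inE // adj_sym; by case: (G _ _).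
  by rewrite eq_sym; apply: neq_mem uX (fX j).
have IX z : z \in I -> z \notin X.
  by move=> zI; apply/negP=> zX; move/setP/(_ z): I0; rewrite !inE zI zX.
have same p q : p \in I -> q \in I -> {in X, G p =1 G q}.
  move=> pI qI z zX; rewrite ![G _ z]adj_sym; apply: hI'; rewrite ?inE //.
  by apply: contraL zX; apply: IX.
have samet i j : f i \in I -> f j \in I -> t i = t j.
  move=> iI jI; apply: typed_inj iX X3 (ft i) _; have [_ tX h] := typedP _ _ _ _ (ft j).
  by apply/typedP; split=> // z zX; rewrite (same _ _ iI jI) ?h.
have [p [q [pI qI pq]]] := card_gt1_ex I1.
have [i pi] := outer p (IX p pI); have [j qj] := outer q (IX q qI).
rewrite {}pi {}qj in pI qI pq; have ij : i != j by rewrite -(inj_eq f_inj).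
have [k kij] := path_separates ij.
have ok : odd k != odd i.
  have oij : odd i = odd j by apply: path_extension_odd; rewrite (samet i j).
  case e: (path_rel k i) kij => e'; [|rewrite oij]; apply: path_rel_odd => //.
  by move: e'; case: path_rel.
have kI : f k \notin I.
  by apply: contra ok => kI; apply/eqP; apply: path_extension_odd; rewrite (samet k i).
have oij : odd i = odd j by apply: path_extension_odd; rewrite (samet i j).
have ki : k != i by apply: contraNneq ok => ->.
have kj : k != j by apply: contraNneq ok => ->; rewrite oij.
have := hI' (f k) (f i) (f j) (in_setT _) kI pI qI; rewrite !fG //.
rewrite (path_extension_row (q := t k) (p := f i) (r := f j)) ?fX //; last first.
- exact: same.
- by case/typedP: (ft k).
by move/addIb/eqP; rewrite (negPf kij).
Qed.

(** Three vertices of the path include an isolated one (k = l) or two twins of equal parity. The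
    former follows its attachment on all that is left; the latter form an interval. *)
Lemma path_del_pair (i j : 'I_5) : i != j ->
  exists k l : 'I_5, [/\ k \notin [:: i; j], l \notin [:: i; j], odd k = odd l &
    forall r : 'I_5, r \notin [:: i; j] -> r != k -> r != l ->
      if k == l then ~~ path_rel k r else path_rel r k == path_rel r l].
Proof.
pose ok i j k l := [&& k \notin [:: i; j], l \notin [:: i; j], odd k == odd l &
  all (fun r => (r \notin [:: i; j]) ==> (r != k) ==> (r != l) ==>
    if k == l then ~~ path_rel k r else path_rel r k == path_rel r l) (iota 0 5)].
have h : all (fun i => all (fun j => (i == j) ||
    has (fun k => has (ok i j k) (iota 0 5)) (iota 0 5)) (iota 0 5)) (iota 0 5).
  by vm_compute.
move=> ij; have r5 (k : 'I_5) : nat_of_ord k \in iota 0 5.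
  by rewrite mem_iota ltn_ord.
have := allP (allP h i (r5 i)) j (r5 j); rewrite val_eqE (negPf ij) orFb.
case/hasP=> k; rewrite mem_iota => k5 /hasP[l]; rewrite mem_iota => l5.
case/and4P=> ki li /eqP o /allP hr.
have mE (a : 'I_5) : (a \notin [:: i; j]) = (val a \notin [:: val i; val j]).
  by rewrite !inE.
exists (Ordinal (k5 : k < 5)), (Ordinal (l5 : l < 5)); rewrite !mE; split=> // r.
rewrite mE -!val_eqE /= => ri rk rl; have := hr r (r5 r).
by rewrite ri rk rl.
Qed.

Lemma path_extension_del_pair x y : x \notin X -> y \notin X -> x != y ->
  ~~ indec (~: [set x; y]).
Proof.
move=> /path_extension_onto[i ->] /path_extension_onto[j ->].
rewrite (inj_eq f_inj) => ij; have [k [l [kij lij okl hr]]] := path_del_pair ij.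
have XY : X \subset ~: [set f i; f j].
  by apply/subsetP=> z zX; rewrite !inE negb_or !(neq_mem zX).
have outY r : f r \in ~: [set f i; f j] = (r \notin [:: i; j]).
  by rewrite !inE !(inj_eq f_inj).
have [kl | kl] := eqVneq k l.
  apply: (@follow_class_decomposable _ _ X _ (t k).1 [set f k]) => //.
  - exact: ltnW.
  - by apply/subsetP=> z /set1P->; rewrite outY.
  - by apply/set0Pn; exists (f k); rewrite inE.
  move=> _ /set1P->; exists (t k).2; rewrite -surjective_pairing // => w wY wX.
  have [r wr] := path_extension_onto wX; rewrite {}wr in wY wX *.
  rewrite inE (inj_eq f_inj) => rk; rewrite outY in wY.
  have := hr r wY rk; rewrite -kl eqxx => /(_ rk) /negPf nkr.
  by rewrite fG 1?eq_sym // nkr.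
apply/indecNP; exists [set f k; f l]; last first.
  rewrite cards2 (inj_eq f_inj) kl; split=> //.
  have /card_gt0P[a aX] : 0 < #|X| by apply: leq_trans X3.
  apply/negP=> /eqP/setP/(_ a); rewrite (subsetP XY) // !inE.
  by rewrite !(negPf (neq_mem aX _)).
split=> [|v p q vY]; first by apply/subsetP=> z /set2P[]->; rewrite outY.
have [_ _ hk] := typedP _ _ _ _ (ft k); have [_ _ hl] := typedP _ _ _ _ (ft l).
have same : {in X, G (f k) =1 G (f l)} by move=> z zX; rewrite hk // hl // okl.
rewrite !inE negb_or => /andP[vk vl].
suff E : G v (f k) = G v (f l) by move=> /orP[]/eqP-> /orP[]/eqP->.
have [vX | vX] := boolP (v \in X); first by rewrite ![G v _]adj_sym same.
have [r vr] := path_extension_onto vX; rewrite {}vr in vY vX vk vl *.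
rewrite !(inj_eq f_inj) in vk vl; rewrite outY in vY.
have := hr r vY vk vl; rewrite (negPf kl) => /eqP E; rewrite !fG // E.
congr (_ (+) _); apply: path_extension_row => //.
by case/typedP: (ft r).
Qed.

End PathExtensionTheory.
(** One interval of G - x serves for all y that leave two elements inside it and one outside, so
    only x has to be treated case by case. *)
Lemma del_pair_decomposable (V : finType) (G : sgraph V) (I : {set V})
    (x y p q z : V) : interval_of G (~: [set x]) I ->
  p \in I -> q \in I -> p != q -> p != y -> q != y ->
  z \notin I -> z != x -> z != y -> ~~ indec G (~: [set x; y]).
Proof.
move=> hI pI qI pq py qy zI zx zy; set Y := ~: [set x; y].
have Yx : Y \subset ~: [set x].
  by apply/subsetP=> v; rewrite !inE negb_or => /andP[].
have inY v : v \in I -> v != y -> v \in I :&: Y.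
  move=> vI vy; rewrite !inE vI negb_or vy andbT /=.
  by case: hI => /subsetP/(_ v vI) + _; rewrite !inE.
apply/indecNP; exists (I :&: Y); first exact: interval_of_sub hI.
split; first exact: card_gt1_in (inY p pI py) (inY q qI qy) pq.
apply/negP=> /eqP/setP/(_ z); rewrite inE (negPf zI) /= !inE negb_or zx.
by rewrite zy.
Qed.

(** * Removing a pair that avoids 1 and n - 5 *)

Section Covered.
Variables (V : finType) (G : sgraph V) (X : {set V}) (m : nat) (lab : nat -> V).
Hypothesis m7 : 6 < m.
Hypothesis labX : forall x,
  reflect (exists2 a, 0 < a <= m & x = lab a) (x \in X).
Hypothesis lab_inj : forall a b, 0 < a <= m -> 0 < b <= m -> lab a = lab b -> a = b.
Hypothesis labG : forall a b, 0 < a <= m -> 0 < b <= m ->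
  G (lab a) (lab b) = Q_label_adj m a b.

Let m4 : 3 < m. Proof. exact: leq_trans m7. Qed.

Let lab_neq a b : 0 < a <= m -> 0 < b <= m -> a != b -> lab a != lab b.
Proof. by move=> ha hb; apply: contraNneq => /lab_inj->. Qed.

Let leaf_like w := forall a, 0 < a <= m -> G w (lab a) = (a == m - 1).

Lemma leaf_typed w : typed G X (Some (lab m), false) w -> leaf_like w.
Proof.
case/typedP=> wX mX h a ha; rewrite h; last by apply/labX; exists a.
rewrite /row /= labG; last by clear -ha; lia.
  have [/lab_inj-> //|am] := eqVneq (lab a) (lab m).
  - by clear -m4; lia.
  - by clear -ha; lia.
  by rewrite Q_label_leaf //; case/andP: ha.
by clear -m4; lia.
Qed.

(** Leaving out label 1 makes the formula independent of [b]; [del_pair_first] gets by without the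
    adjacencies at label 1. *)
Lemma first_typed w b : typed G X (Some (lab 1), b) w ->
  forall a, 1 < a <= m -> G w (lab a) = (a == 2) || (a == m - 1).
Proof.
case/typedP=> wX _ h a ha; rewrite h; last by apply/labX; exists a => //; clear -ha; lia.
rewrite /row /= (negPf (lab_neq _ _ _)) ?labG; [|clear -ha m4; lia..].
by rewrite /Q_label_adj /Q_star /path_rel; clear -ha m7; lia.
Qed.

(* The vertices of the path before the removed one form an interval; when the
   second vertex of the path is removed, the first one becomes a twin of the
   leaf m. *)
Lemma del_pair_const a y : 1 < a < m -> y != lab 1 -> y != lab m -> y != lab a ->
  (forall w, w \notin X -> leaf_like w \/
     exists b, forall c, 0 < c <= m -> G w (lab c) = b) ->
  ~~ indec G (~: [set lab a; y]).
Proof.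
move=> ha y1 ym ya out.
have lab1m : lab 1 != lab m by apply: lab_neq; clear -m4; lia.
have second z : z != lab 1 -> z != lab m -> z != lab 2 ->
    ~~ indec G (~: [set lab 2; z]).
  (* Label c is a witness outside the twins 1 and m that survives both removals. *)
  move=> z1 zm z2; pose c := if z == lab 3 then 4 else 3.
  have hc : 2 < c < 5 by rewrite /c; case: ifP.
  have zc : z != lab c.
    rewrite /c; case: ifP => [/eqP->|/negbT //].
    by apply: lab_neq; clear -m7; lia.
  apply: (@del_pair_decomposable _ _ [set lab 1; lab m] _ _ (lab 1) (lab m) (lab c));
    rewrite ?inE ?eqxx ?orbT //; last first.
  - by rewrite eq_sym.
  - by apply: lab_neq; clear -m7 hc; lia.
  - by rewrite negb_or !lab_neq //; clear -m7 hc; lia.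
  - by rewrite eq_sym.
  - by rewrite eq_sym.
  split=> [|v p q].
    by apply/subsetP=> v /set2P[]->; rewrite !inE; apply: lab_neq; clear -m7; lia.
  rewrite !inE negb_or => v2 /andP[v1 vm].
  suff E : G v (lab 1) = G v (lab m) by move=> /orP[]/eqP-> /orP[]/eqP->.
  have [/labX[i hi vi] | /out] := boolP (v \in X); last first.
    by case=> [h | [b h]]; rewrite !h //; clear -m7; lia.
  have i1 : i != 1 by apply: contraNneq v1 => <-; rewrite vi.
  have i2 : i != 2 by apply: contraNneq v2 => <-; rewrite vi.
  have im : i != m by apply: contraNneq vm => <-; rewrite vi.
  have h1 : 0 < 1 <= m by clear -m7; lia.
  have hm : 0 < m <= m by clear -m7; lia.
  rewrite vi (labG hi h1) (labG hi hm).
  by rewrite /Q_label_adj /Q_star /path_rel; clear -m7 hi i1 i2 im; lia.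
have [a2|a2] := eqVneq a 2; first by rewrite a2; apply: second; rewrite // -a2.
(* The roles of the two removed vertices are exchanged here; afterwards labels 1 and 2 both survive
   below a. *)
have [y2|y2] := eqVneq y (lab 2).
  rewrite setUC y2; apply: second.
  - by apply: lab_neq; clear -ha; lia.
  - by apply: lab_neq; clear -ha; lia.
  - by apply: lab_neq; clear -ha a2; lia.
pose I := [set v in X | [exists i : 'I_m, (0 < i < a) && (v == lab i)]].
have IP v : reflect (exists2 i, 0 < i < a & v = lab i) (v \in I).
  rewrite inE; apply: (iffP andP) => [[_ /existsP[i /andP[hi /eqP->]]]|[i hi ->]].
    by exists i.
  split; first by apply/labX; exists i => //; clear -ha hi; lia.
  have im : i < m by clear -ha hi; lia.
  by apply/existsP; exists (Ordinal im); rewrite /= hi eqxx.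
apply: (@del_pair_decomposable _ _ I _ _ (lab 1) (lab 2) (lab m)).
- split=> [|v p q].
    apply/subsetP=> v /IP[i hi ->]; rewrite !inE.
    by apply: lab_neq; clear -ha hi; lia.
  rewrite in_setC in_set1 => va vI /IP[i hi ->] /IP[j hj ->].
  have [/labX[k hk vk] | /out] := boolP (v \in X); last first.
    by case=> [h | [b h]]; rewrite !h //; clear -ha hi hj; lia.
  have ka : k != a by apply: contraNneq va => <-; rewrite vk.
  have ak : a < k.
    rewrite ltn_neqAle eq_sym ka /=; move: vI; apply: contraR; rewrite -ltnNge.
    by move=> ak; apply/IP; exists k; rewrite // ak andbT; case/andP: hk.
  have hi' : 0 < i <= m by clear -ha hi; lia.
  have hj' : 0 < j <= m by clear -ha hj; lia.
  rewrite vk (labG hk hi') (labG hk hj').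
  by rewrite /Q_label_adj /Q_star /path_rel; clear -ak hk ha hi hj; lia.
- by apply/IP; exists 1 => //; clear -ha; lia.
- by apply/IP; exists 2 => //; clear -ha a2; lia.
- by apply: lab_neq; clear -m7; lia.
- by rewrite eq_sym.
- by rewrite eq_sym.
- apply/IP=> -[i hi] /lab_inj; clear -ha hi => h; have := h _ _; lia.
- by apply: lab_neq; clear -ha; lia.
by rewrite eq_sym.
Qed.

(** Without m - 1, the vertex m is isolated and the rest is an interval. Otherwise, after the
    removal of a, the vertices with no label from a to m - 1 form an interval: m - 1 is joined to
    all of them, and the labels strictly between a and m - 1 to none. *)
Lemma del_pair_first a y : 1 < a < m -> y != lab 1 -> y != lab m -> y != lab a ->
  (forall w, w \notin X -> leaf_like w \/
     forall c, 1 < c <= m -> G w (lab c) = (c == 2) || (c == m - 1)) ->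
  ~~ indec G (~: [set lab a; y]).
Proof.
move=> ha y1 ym ya out.
have hub z : z != lab 1 -> z != lab m -> z != lab (m - 1) ->
    ~~ indec G (~: [set lab (m - 1); z]).
  move=> z1 zm zh; pose c := if z == lab 2 then 3 else 2.
  have hc : 1 < c < 4 by rewrite /c; case: ifP.
  have zc : z != lab c.
    rewrite /c; case: ifP => [/eqP->|/negbT //].
    by apply: lab_neq; clear -m7; lia.
  apply: (@del_pair_decomposable _ _ (~: [set lab (m - 1); lab m]) _ _
            (lab 1) (lab c) (lab m)).
  - split=> [|v p q].
      by apply/subsetP=> v; rewrite !inE negb_or => /andP[].
    rewrite !inE negbK => vh; rewrite (negPf vh) /= => /eqP->.
    have k p' : ~~ ((p' == lab (m - 1)) || (p' == lab m)) -> G (lab m) p' = false.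
      rewrite negb_or => /andP[p'h p'm].
      have [/labX[i hi pi] | /out[] h] := boolP (p' \in X).
      - have hm : 0 < m <= m by clear -m7; lia.
        rewrite pi (labG hm hi) Q_label_leaf //; last by case/andP: hi.
        by apply/negbTE; apply: contraNneq p'h => <-; rewrite pi.
      - by rewrite adj_sym h; clear -m7; lia.
      by rewrite adj_sym h; clear -m7; lia.
    by move=> /k-> /k->.
  - by rewrite !inE negb_or !lab_neq //; clear -m7; lia.
  - by rewrite !inE negb_or !lab_neq //; clear -m7 hc; lia.
  - by apply: lab_neq; clear -m7 hc; lia.
  - by rewrite eq_sym.
  - by rewrite eq_sym.
  - by rewrite !inE eqxx orbT.
  - by apply: lab_neq; clear -m7; lia.
  by rewrite eq_sym.
have [am|am] := eqVneq a (m - 1); first by rewrite am; apply: hub; rewrite // -am.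
have [yh|yh] := eqVneq y (lab (m - 1)).
  rewrite setUC yh; apply: hub.
  - by apply: lab_neq; clear -ha; lia.
  - by apply: lab_neq; clear -ha; lia.
  - by apply: lab_neq; clear -ha am; lia.
pose J := [set v in X | [exists i : 'I_m, (a <= i < m) && (v == lab i)]].
have JP v : reflect (exists2 i, a <= i < m & v = lab i) (v \in J).
  rewrite inE; apply: (iffP andP) => [[_ /existsP[i /andP[hi /eqP->]]]|[i hi ->]].
    by exists i.
  split; first by apply/labX; exists i => //; clear -ha hi; lia.
  have im : i < m by case/andP: hi.
  by apply/existsP; exists (Ordinal im); rewrite /= hi eqxx.
apply: (@del_pair_decomposable _ _ (~: J) _ _ (lab 1) (lab m) (lab (m - 1))).
- split=> [|v p q].
    apply/subsetP=> v; rewrite !in_setC in_set1; apply: contra => /eqP->.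
    by apply/JP; exists a; rewrite // leqnn; case/andP: ha.
  rewrite !in_setC negbK in_set1 => va /JP[i hi vi].
  have ai : a != i by apply: contraNneq va => ->; rewrite vi.
  have k p' : p' \notin J -> G v p' = (i == m - 1).
    move=> p'J; rewrite vi; have [/labX[j hj pj] | /out[] h] := boolP (p' \in X).
    - have hi' : 0 < i <= m by clear -ha hi; lia.
      rewrite pj (labG hi' hj).
      have hj' : (j < a) || (j == m).
        move: p'J; apply: contraR; rewrite negb_or -leqNgt => /andP[aj jm].
        by apply/JP; exists j; rewrite // aj ltn_neqAle jm; case/andP: hj.
      by rewrite /Q_label_adj /Q_star /path_rel; clear -m7 ha hi hj ai hj'; lia.
    - by rewrite adj_sym h //; clear -ha hi; lia.
    by rewrite adj_sym h; clear -ha hi ai; lia.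
  by move=> /k-> /k->.
- rewrite in_setC; apply/JP=> -[i hi] /lab_inj; clear -ha hi => h; have := h _ _; lia.
- rewrite in_setC; apply/JP=> -[i hi] /lab_inj; clear -ha hi => h; have := h _ _; lia.
- by apply: lab_neq; clear -m7; lia.
- by rewrite eq_sym.
- by rewrite eq_sym.
- rewrite in_setC negbK; apply/JP; exists (m - 1) => //; clear -ha; lia.
- by apply: lab_neq; clear -ha am; lia.
by rewrite eq_sym.
Qed.

Lemma path_extension_covered t0 t1 f : path_extension G X t0 t1 f ->
  let leaf := (Some (lab m), false) in
  let other t := exists b, t = (None, b) \/ t = (Some (lab 1), b) in
  (t0 = leaf /\ other t1) \/ (t1 = leaf /\ other t0) ->
  forall x y, x \notin [set lab 1; lab m] -> y \notin [set lab 1; lab m] ->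
    x != y -> ~~ indec G (~: [set x; y]).
Proof.
move=> hf leaf other h01.
have iX : indec G X by apply: (Q_label_indec m4 labX labG).
have X3 : 2 < #|X| by rewrite (card_labelled labX lab_inj); apply: leq_trans m7.
have main a y : lab a \notin [set lab 1; lab m] -> y \notin [set lab 1; lab m] ->
    0 < a <= m -> lab a != y -> ~~ indec G (~: [set lab a; y]).
  rewrite !inE !negb_or => /andP[a1 am] /andP[y1 ym] ha ay.
  have ha' : 1 < a < m.
    have na1 : a != 1 by apply: contraNneq a1 => ->.
    have nam : a != m by apply: contraNneq am => ->.
    by clear -ha na1 nam; lia.
  have [t [b ht] ot] : exists2 t, other t & forall w, w \notin X ->
      typed G X leaf w \/ typed G X t w.
    case: h01 => [] [E h]; [exists t1 | exists t0] => // w wX;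
    by have [h'|h'] := path_extension_typed hf wX; rewrite ?E in h'; auto.
  case: ht => ht; [apply: del_pair_const | apply: del_pair_first] => //;
    rewrite 1?eq_sym // => w wX; case: (ot w wX) => [/leaf_typed|]; try by left.
    rewrite ht => /typedP[_ _ h]; right; exists b => c hc; rewrite h //.
    by apply/labX; exists c.
  by rewrite ht => /first_typed h; right.
move=> x y xC yC xy; have [/labX[a ha xa] | xX] := boolP (x \in X).
  by rewrite xa; apply: main; rewrite -?xa.
have [/labX[a ha ya] | yX] := boolP (y \in X).
  by rewrite setUC ya; apply: main; rewrite -?ya // eq_sym.
exact: (path_extension_del_pair X3 hf xX yX xy).
Qed.

End Covered.

(** * Translation into the classes of q_X and the graph G_X *)

Section OuterGraph.
Variables (V : finType) (G : sgraph V).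
Implicit Types (X Y I : {set V}) (t : option V * bool) (x y u v w : V).

Definition attached X t : {set V} := [set w | typed G X t w].

Lemma Xm_attached X : Xm G X = attached X (None, false).
Proof.
apply/setP=> w; rewrite !inE; congr (_ && _); apply: eq_forallb => x.
by rewrite /row /=; case: (G w x).
Qed.

Lemma Xp_attached X : Xp G X = attached X (None, true).
Proof.
apply/setP=> w; rewrite !inE; congr (_ && _); apply: eq_forallb => x.
by rewrite /row /=; case: (G w x).
Qed.

Lemma induced_intervalP X I : I \subset X ->
  reflect (interval_of G X I) (interval (induced G X) (val @^-1: I)).
Proof.
move=> IX; apply: (iffP (intervalP _ _)) => [] [_ h]; split.
- exact: IX.
- move=> v x y vX vI xI yI.
  have := h (Sub v vX) (Sub x (subsetP IX x xI)) (Sub y (subsetP IX y yI)).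
  by rewrite !inE /=; apply.
- exact: subsetT.
by move=> v x y _; rewrite !inE; apply: h (valP v).
Qed.

(** Being a twin of u leaves the adjacency of w and u open, so the sign of the attachment is [G w u]
    itself. *)
Lemma Xat_typed X u w : u \in X -> 1 < #|X| ->
  (w \in Xat G X u) = typed G X (Some u, G w u) w.
Proof.
move=> uX X1; rewrite inE in_setC /typed /= uX /=.
case: (boolP (w \in X)) => //= wX.
have sub : [set u; w] \subset w |: X.
  by apply/subsetP=> z /set2P[]->; rewrite !inE ?uX ?eqxx ?orbT.
apply/(induced_intervalP sub)/forall_inP => [[_ h] z zX | h]; last first.
  split=> // v x y; rewrite !inE negb_or => /orP[->|vX]; first by rewrite andbF.
  case/andP=> vu vw.
  suff E : G v u = G v w by move=> /orP[]/eqP-> /orP[]/eqP->.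
  have /eqP := h v vX; rewrite /row /= (negPf vu) adj_sym => ->.
  by rewrite adj_sym.
rewrite /row /=; case: (eqVneq z u) => [-> // | zu].
rewrite ![G _ z]adj_sym; apply/eqP; apply: h; rewrite !inE ?zX ?eqxx ?orbT //.
by rewrite negb_or zu (neq_mem zX).
Qed.

Lemma typed_at X u b w : u \in X -> typed G X (Some u, b) w -> G w u = b.
Proof. by move=> uX /typedP[_ _ h]; rewrite h // /row /= eqxx. Qed.

Lemma Xatm_attached X u : u \in X -> 1 < #|X| ->
  Xatm G X u = attached X (Some u, false).
Proof.
move=> uX X1; apply/setP=> w; rewrite in_set Xat_typed // [RHS]inE.
case e: (G w u) => /=; first rewrite andbF; last by rewrite andbT.
by apply/esym/negP=> /(typed_at uX); rewrite e.
Qed.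

Lemma Xatp_attached X u : u \in X -> 1 < #|X| ->
  Xatp G X u = attached X (Some u, true).
Proof.
move=> uX X1; apply/setP=> w; rewrite in_set Xat_typed // [RHS]inE.
case e: (G w u) => /=; first by rewrite andbT.
by rewrite andbF; apply/esym/negP=> /(typed_at uX); rewrite e.
Qed.

(** This turns the emptiness of the classes in q_X^- and the completeness of those in q_X^+ into one
    rule: equal attachments follow their row. *)
Lemma row_attached X t w : w \in attached X t -> row G t w = t.2.
Proof.
rewrite inE => wt; have [wX tX _] := typedP _ _ _ _ wt.
rewrite (row_notin _ wX tX); case: t tX {wX} wt => [[u|] b] //= uX wt.
by rewrite adj_sym (typed_at uX wt).
Qed.

(** Equal attachments mean equal parity on the path, hence no deviation. It holds for every [t], as
    only [t0] and [t1] have vertices attached by them. *)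
Lemma path_extension_sign X t0 t1 f t x y : indec G X -> 2 < #|X| ->
  path_extension G X t0 t1 f -> x \in attached X t -> y \in attached X t ->
  x != y -> G x y = t.2.
Proof.
move=> iX X3 hf xt yt; have := xt; have := yt; rewrite !inE => yt' xt'.
have [yX _ _] := typedP _ _ _ _ yt'; have [xX _ _] := typedP _ _ _ _ xt'.
have [i xi] := path_extension_onto hf xX; have [j yj] := path_extension_onto hf yX.
rewrite {}xi {}yj in xt yt xt' yt' *; case: hf => f_inj _ t01 ft fG.
rewrite (inj_eq f_inj) => ij; have Ei := typed_inj iX X3 (ft i) xt'.
have Ej := typed_inj iX X3 (ft j) yt'.
rewrite fG // Ei (row_attached yt); case: (boolP (path_rel i j)) => // /path_rel_odd.
move: t01; rewrite -Ei in Ej; move: Ej.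
by case: (odd i); case: (odd j) => //= ->; rewrite eqxx.
Qed.

Lemma path_extension_outer_graph X t0 t1 f : indec G X -> 2 < #|X| ->
  path_extension G X t0 t1 f -> graph_iso (outer_graph G X) (P_graph 5).
Proof.
move=> iX X3 hf; have [f_inj fE _ ft _] := hf.
have fX i : f i \in ~: X by rewrite inE; case/typedP: (ft i).
pose h i : {x | x \in ~: X} := Sub (f i) (fX i).
have h_inj : injective h by move=> i j /(congr1 val) /f_inj.
have [g hg gh] : bijective h.
  apply: inj_card_bij => //; rewrite card_sig card_ord.
  by rewrite -(card_ord 5) -(card_imset _ f_inj) fE.
exists g => [|x y]; first by exists h.
rewrite -{2}[x]gh -{2}[y]gh /= /outer_adj (inj_eq h_inj) /=.
rewrite -/(indec G _) (path_extension_pair iX X3 hf) /path_adj.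
have [->|//] := eqVneq (g x) (g y); exact: path_rel_irrefl.
Qed.

Lemma path_extension_bipartition X t0 t1 f : indec G X -> 2 < #|X| ->
  path_extension G X t0 t1 f ->
  bipartition (outer_graph G X) (val @^-1: attached X t0) (val @^-1: attached X t1).
Proof.
move=> iX X3 hf; have [_ _ t01 _ _] := hf.
have indep t : {in val @^-1: attached X t &, forall a b, ~~ outer_graph G X a b}.
  move=> x y; rewrite !inE => xt yt; rewrite /= /outer_adj negb_and.
  by apply/orP; right; apply: same_block_decomposable xt yt _; rewrite // ltnW.
split=> //; apply/setP=> x; rewrite !inE.
  apply/negP=> /andP[x0 x1]; move: t01.
  by rewrite (typed_inj iX X3 x0 x1) eqxx.
have xX : val x \notin X by have := valP x; rewrite inE.
by have [->|->] := path_extension_typed hf xX; rewrite ?orbT.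
Qed.

(** Colour classes alternate along P_5, and the class of its first vertex decides which attachment
    plays [t0]. Adjacency inside a class is given by the sign, between classes by G_X through
    [follow_decomposable] and its converse. *)
Lemma outer_graph_path_extension X tA tB : indec G X -> 2 < #|X| ->
  tA.1 != tB.1 -> graph_iso (outer_graph G X) (P_graph 5) ->
  bipartition (outer_graph G X) (val @^-1: attached X tA) (val @^-1: attached X tB) ->
  (forall t x y, t = tA \/ t = tB -> x \in attached X t -> y \in attached X t ->
     x != y -> G x y = t.2) ->
  exists f, path_extension G X tA tB f \/ path_extension G X tB tA f.
Proof.
move=> iX X3 AB [g [h gh hg] gG] [ABI ABU indA indB] sign.
pose f i := val (h i).
have f_inj : injective f by move=> i j /val_inj/(can_inj hg).
have E i j : outer_graph G X (h i) (h j) = path_rel i j by rewrite -gG !hg.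
have fX i : f i \notin X by have := valP (h i); rewrite inE.
pose inA (i : 'I_5) := typed G X tA (f i).
have AorB i : inA i || typed G X tB (f i).
  by have := in_setT (h i); rewrite -ABU !inE.
have ft i : typed G X (if inA i then tA else tB) (f i).
  by have := AorB i; case e: (inA i).
have alt (i j : 'I_5) : path_rel i j -> inA i = ~~ inA j.
  rewrite -E => ij; have := AorB i; have := AorB j.
  case ei: (inA i); case ej: (inA j) => //= jB iB.
    by have := indA (h i) (h j); rewrite !inE -/(inA i) -/(inA j) ei ej ij => /(_ isT isT).
  by have := indB (h i) (h j); rewrite !inE iB jB ij => /(_ isT isT).
pose o k : 'I_5 := inord k.
have par (i : 'I_5) : inA i = inA (o 0) (+) odd i.
  have step k : k < 4 -> inA (o k.+1) = ~~ inA (o k).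
    by move=> k4; apply: alt; rewrite !inordK ?ltnS // 1?ltnW // /path_rel eqxx orbT.
  have all k : k < 5 -> inA (o k) = inA (o 0) (+) odd k.
    elim: k => [|k IH] k5; first by rewrite addbF.
    by rewrite step // IH 1?ltnW //= addbN.
  by rewrite -(all i (ltn_ord i)) /o inord_val.
have main i j : i != j -> G (f i) (f j) =
    path_rel i j (+) row G (if inA i then tA else tB) (f j).
  move=> ij; have fij : f i != f j by rewrite (inj_eq f_inj).
  have hij : h i != h j by rewrite (inj_eq (can_inj hg)).
  have Eij : indec G (X :|: [set f i; f j]) = path_rel i j.
    by rewrite -E /= /outer_adj hij.
  have [eij|eij] := eqVneq (inA i) (inA j).
    have -> : path_rel i j = false.
      by apply/negP=> /alt; rewrite eij; case: (inA j).
    have jt : f j \in attached X (if inA i then tA else tB).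
      by rewrite inE eij.
    have it : f i \in attached X (if inA i then tA else tB) by rewrite inE.
    rewrite (row_attached jt); apply: (sign _ _ _ _ it jt fij).
    by case: (inA i); [left | right].
  case p: (path_rel i j) Eij => Eij /=.
    have : G (f i) (f j) != row G (if inA i then tA else tB) (f j).
      apply: contraTneq Eij => h'.
      exact: (follow_decomposable (ltnW X3) (ft i) (fX j) fij h').
    by case: (G _ _); case: row.
  apply: (decomposable_follow iX X3 (ft i) (fX j) fij); last by rewrite Eij.
  move=> t' /(typed_inj iX X3 (ft j)) <-; move: eij.
  by case: (inA i); case: (inA j) => //= _; rewrite eq_sym.
have onto : f @: 'I_5 = ~: X.
  apply/setP=> x; rewrite inE; apply/imsetP/idP => [[i _ ->] // | xX].
  have xC : x \in ~: X by rewrite inE.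
  by exists (g (Sub x xC)); rewrite // /f gh.
exists f; case e: (inA (o 0)) par => par; [left | right]; split=> //.
- by move=> i; have := ft i; rewrite par; case: odd.
- by move=> i j ij; rewrite main // par; case: (odd i).
- by rewrite eq_sym.
- by move=> i; have := ft i; rewrite par; case: odd.
by move=> i j ij; rewrite main // par; case: (odd i).
Qed.

End OuterGraph.

(** * Graphs on the labels 1, ..., n *)

Section Labels.
Variables (k : nat) (G : sgraph 'I_k.+1).
Local Notation n := k.+1.
Local Notation m := (n - 5).
Hypothesis n12 : 12 <= n.

Let X : {set 'I_n} := [set i : 'I_n | i.+1 <= m].
(** Label a is the ordinal a - 1; [n] is a successor because [inord] needs a nonempty ordinal
    type. *)
Let lab (a : nat) : 'I_n := inord a.-1.

Let m7 : 6 < m. Proof. by clear -n12; lia. Qed.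
Let m4 : 3 < m. Proof. exact: leq_trans m7. Qed.

Let val_lab a : 0 < a <= m -> (lab a).+1 = a.
Proof. by move=> ha; rewrite /lab inordK; clear -ha n12; lia. Qed.

Let labX x : reflect (exists2 a, 0 < a <= m & x = lab a) (x \in X).
Proof.
rewrite inE; apply: (iffP idP) => [xm | [a ha ->]]; last first.
  by rewrite val_lab //; case/andP: ha.
by exists x.+1; rewrite // /lab /= inord_val.
Qed.

Let lab_inj a b : 0 < a <= m -> 0 < b <= m -> lab a = lab b -> a = b.
Proof. by move=> /val_lab + /val_lab + E; rewrite E => -> ->. Qed.

Let induced_eqP : induced_eq G X (Q_graph m) <->
  (forall a b, 0 < a <= m -> 0 < b <= m ->
     G (lab a) (lab b) = Q_label_adj m a b).
Proof.
split=> [[_ h] a b ha hb | h].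
  have ia : a.-1 < m by clear -ha; lia.
  have ib : b.-1 < m by clear -hb; lia.
  have a0 : 0 < a by case/andP: ha.
  have b0 : 0 < b by case/andP: hb.
  have la : lab a = a.-1 :> nat by apply: succn_inj; rewrite val_lab ?prednK.
  have lb : lab b = b.-1 :> nat by apply: succn_inj; rewrite val_lab ?prednK.
  rewrite (h _ _ (Ordinal ia) (Ordinal ib)) //; last 2 first.
  - by apply/labX; exists a.
  - by apply/labX; exists b.
  by rewrite -[LHS]/(Q_label_adj m a.-1.+1 b.-1.+1) !prednK.
split=> [a | x y i j xX yX xi yj].
  split=> [am | [x]]; last by rewrite inE => xm <-.
  by exists (lab a.+1); [apply/labX; exists a.+1 | apply: succn_inj; apply: val_lab].
have lE (z : 'I_n) (l : 'I_m) : z = l :> nat -> z = lab l.+1.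
  by move=> zl; apply: val_inj; apply: succn_inj; rewrite val_lab /= ?zl.
rewrite (lE x i xi) (lE y j yj).
exact: (h i.+1 j.+1 (ltn_ord i) (ltn_ord j)).
Qed.

Let label_setC : ~: label_set n [:: n; n - 1; n - 2; n - 3; n - 4] = X.
Proof.
by apply/setP=> i; rewrite !inE; have := ltn_ord i; clear -n12; lia.
Qed.

Let label_set_ends : label_set n [:: 1; n - 5] = [set lab 1; lab m].
Proof.
apply/setP=> i; have E a : 0 < a <= m -> (i == lab a) = (i.+1 == a).
  by move=> ha; rewrite -val_eqE -eqSS /= val_lab.
by rewrite !inE !E //; clear -n12; lia.
Qed.

Let cardX : #|X| = m.
Proof. exact: card_labelled labX lab_inj. Qed.

Let cardCX : #|~: X| = 5.
Proof.
by apply/eqP; rewrite -(eqn_add2l #|X|) cardsC cardX card_ord; clear -n12; lia.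
Qed.

Let X3 : 2 < #|X|. Proof. by rewrite cardX; apply: leq_trans m7. Qed.

Let coveredP : covered (indec_graph G) (label_set n [:: 1; n - 5]) <->
  (forall x y, x \notin [set lab 1; lab m] -> y \notin [set lab 1; lab m] ->
    x != y -> ~~ indec G (~: [set x; y])).
Proof.
rewrite label_set_ends; split=> h x y.
  move=> xC yC xy; apply/negP=> i; have := h x y.
  by rewrite (negPf xC) (negPf yC) /= /indec_graph_adj xy => /(_ i).
case/andP=> xy i; apply: contraT; rewrite negb_or => /andP[xC yC].
by have /negP[] := h x y xC yC xy; exact: i.
Qed.

Let leaf : option 'I_n * bool := (Some (lab m), false).
Let other (t : option 'I_n * bool) : Prop :=
  exists b, t = (None, b) \/ t = (Some (lab 1), b).

Let h1 : 0 < 1 <= m. Proof. by clear -n12; lia. Qed.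
Let hm : 0 < m <= m. Proof. by clear -n12; lia. Qed.

Lemma in_Qm5_labels : in_Qm5 G <-> Qm5_form G.
Proof.
have l1X : lab 1 \in X by apply/labX; exists 1.
have lmX : lab m \in X by apply/labX; exists m.
have X1 : 1 < #|X| := ltnW X3.
have classP Z : (exists2 t, other t & Z = attached G X t) <->
    Z \in [:: Xm G X; Xp G X; Xatm G X (lab 1); Xatp G X (lab 1)].
  rewrite Xm_attached Xp_attached Xatm_attached // Xatp_attached // !inE.
  split=> [[t [b [->|->]] ->]|].
  - by case: b; rewrite eqxx ?orbT.
  - by case: b; rewrite eqxx ?orbT.
  case/or4P=> /eqP->.
  - by exists (None, false) => //; exists false; left.
  - by exists (None, true) => //; exists true; left.
  - by exists (Some (lab 1), false) => //; exists false; right.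
  by exists (Some (lab 1), true) => //; exists true; right.
have leafE : Xatm G X (lab m) = attached G X leaf by rewrite Xatm_attached.
split=> [[_ iG cov eqG] | [_]]; last first.
  rewrite -/X => -[eqG qmE qpE iso [v1 [vm [Z [v1E vmE ZE bip]]]]].
  have labG := proj1 induced_eqP eqG.
  have iX : indec G X := Q_label_indec m4 labX labG.
  have v1l : v1 = lab 1 by apply: val_inj; apply: succn_inj; rewrite v1E val_lab.
  have vml : vm = lab m by apply: val_inj; apply: succn_inj; rewrite vmE val_lab.
  rewrite v1l vml leafE in ZE bip; have [t ot Zt] := proj2 (classP Z) ZE.
  have ne : leaf.1 != t.1.
    case: ot => b [->|->] //=; apply/negP=> /eqP[] /lab_inj h.
    by have := h hm h1; clear -n12; lia.
  (* The sign of [q] tells which of the two families, q_X^+ or q_X^-, contains its class. *)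
  have sign q x y : q = leaf \/ q = t -> x \in attached G X q ->
      y \in attached G X q -> x != y -> G x y = q.2.
    move=> hq xq yq xy; have qX : block_in X q.1.
      by case: hq => ->; [|case: ot => b [->|->]].
    case: q {hq} qX xq yq => B [] /= BX xq yq.
      have : attached G X (B, true) \in qp G X.
        case: B BX {xq yq} => [u|] uX; rewrite /qp in_setU1.
          by rewrite -Xatp_attached // imset_f ?orbT.
        by rewrite Xp_attached eqxx.
      by move/qpE=> /(_ (Sub x xq) (Sub y yq)); apply.
    have : attached G X (B, false) \in qm G X.
      case: B BX {xq yq} => [u|] uX; rewrite /qm in_setU1.
        by rewrite -Xatm_attached // imset_f ?orbT.
      by rewrite Xm_attached eqxx.
    by move/qmE=> /(_ (Sub x xq) (Sub y yq)) /negbTE.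
  rewrite Zt in bip.
  have [f hf] := outer_graph_path_extension iX X3 ne iso bip sign.
  have [t0 [t1 [hf' h01]]] : exists t0 t1, path_extension G X t0 t1 f /\
      ((t0 = leaf /\ other t1) \/ (t1 = leaf /\ other t0)).
    by case: hf => hf; [exists leaf, t | exists t, leaf]; split=> //;
      [left | right].
  split=> //; last by rewrite label_setC.
    by rewrite -indecT; apply: path_extension_indec iX X3 hf'.
  apply/coveredP=> x y.
  exact: (path_extension_covered m7 labX lab_inj labG hf' h01).
rewrite label_setC in eqG; have labG := proj1 induced_eqP eqG.
have iX : indec G X := Q_label_indec m4 labX labG.
have nI := proj1 coveredP cov.
have iT : indec G setT by rewrite indecT.
have nI' x y : x \notin X -> y \notin X -> x != y -> ~~ indec G (~: [set x; y]).
  have out v : v \notin X -> v \notin [set lab 1; lab m].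
    by apply: contra => /set2P[]->.
  by move=> xX yX; apply: nI; apply: out.
have [t0 [t1 [f hf]]] := exists_path_extension iT iX X3 cardCX nI'.
have sign := path_extension_sign iX X3 hf.
split=> //; rewrite -/X; split=> //.
- move=> Y YE; have [B YB] : exists B, Y = attached G X (B, false).
    case/setU1P: YE => [->|/imsetP[u uX ->]].
      by exists None; rewrite Xm_attached.
    by exists (Some u); rewrite Xatm_attached.
  rewrite YB => x y; rewrite /= /induced_adj.
  have [->|xy] := eqVneq x y; first by rewrite adj_irrefl.
  by rewrite (sign _ _ _ (valP x) (valP y) xy).
- move=> Y YE; have [B YB] : exists B, Y = attached G X (B, true).
    case/setU1P: YE => [->|/imsetP[u uX ->]].
      by exists None; rewrite Xp_attached.
    by exists (Some u); rewrite Xatp_attached.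
  rewrite YB => x y xy; rewrite /= /induced_adj.
  by rewrite (sign _ _ _ (valP x) (valP y) xy).
- exact: path_extension_outer_graph iX X3 hf.
have bip := path_extension_bipartition iX X3 hf.
have swap A B : bipartition (outer_graph G X) A B -> bipartition (outer_graph G X) B A.
  by case=> *; split; rewrite 1?setIC 1?setUC.
have [] := path_extension_attachments m4 labX lab_inj labG iT cardCX nI m7 hf.
  case=> E ot; exists (lab 1), (lab m), (attached G X t1).
  split; rewrite ?val_lab //; first by apply/classP; exists t1.
  by rewrite leafE /leaf -E.
case=> E ot; exists (lab 1), (lab m), (attached G X t0).
split; rewrite ?val_lab //; first by apply/classP; exists t0.
by rewrite leafE /leaf -E; apply: swap.
Qed.

End Labels.

(** The equivalence holds for each labelled graph, not only up to isomorphism. *)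
Lemma in_Qm5_iff_form n (G : sgraph 'I_n) : in_Qm5 G <-> Qm5_form G.
Proof.
case: n G => [|k] G; first by split=> -[].
have [n12 | n12] := boolP (12 <= k.+1); first exact: in_Qm5_labels.
by split=> -[h]; rewrite h in n12.
Qed.

Theorem proposition4p11 (V : finType) (G : sgraph V) :
  (exists (n : nat) (H : sgraph 'I_n), in_Qm5 H /\ graph_iso G H) <->
  (exists (n : nat) (H : sgraph 'I_n), Qm5_form H /\ graph_iso G H).
Proof.
by split=> -[n [H [hH iso]]]; exists n, H; split=> //; apply/in_Qm5_iff_form.
Qed.
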